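(* Let $G$ be a finitely generated group which is not virtually cyclic, with finite generating set $S$, and let $H\subset G$ be a coarsely geodesically connected subset of infinite diameter. Suppose that $G$ has a contracting element which is strongly independent of $H$. Then there exists $K>0$ such that for every $p>0$ there exist constants $C_1,C_2>0$ with \[\mathbb P_n\left(g\in G:\ C_1\le \frac{\mathcal E_{H,K}(g)}{\log n}\le C_2\right)\ \ge\ 1-O(n^{-p}),\] where $\mathbb P_n$ is the uniform probability measure on the ball of radius $n$ about $e$ in $\mathrm{Cay}(G,S)$.
   Context: $G$ carries the word metric $d$ of $S$; $\mathcal N_R(X)$ is the $R$-neighbourhood of $X$. Nearest-point projection: $\pi_A(y)$ is the set of points of $A$ closest to $y$, $\pi_A(Y)=\bigcup_{y\in Y}\pi_A(y)$. A geodesic $\gamma$ is $D$-contracting if for every geodesic $\kappa$ with $d(\gamma,\kappa)>D$, $\operatorname{diam}(\pi_\gamma(\kappa))<D$; an element is contracting if it has a $D$-contracting axis (an infinite geodesic at bounded Hausdorff distance from $\{g^i\}_{i\in\mathbb Z}$) for some $D$. A contracting element $f$ with axis $\gamma$ is strongly independent of $H$ if $\sup_{t\in G}\operatorname{diam}(\pi_\gamma(tH))<\infty$. $H$ is coarsely geodesically connected if there is $R>0$ such that any $x,y\in H$ are joined by a geodesic contained in $\mathcal N_R(H)$. For a geodesic $\gamma$, its $K$-coarse excursion into $H$ is $\mathcal E_{H,K}(\gamma)=\max_{t\in G}\operatorname{diam}(\gamma\cap\mathcal N_K(tH))$; for $g\in G$, $\mathcal E_{H,K}(g)$ is the maximum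 of $\mathcal E_{H,K}(\gamma)$ over all geodesics $\gamma$ from $e$ to $g$. *)

(* Defs.v *)
From HB Require Import structures.
From mathcomp Require Import all_boot all_order all_algebra.
From mathcomp Require Import boolp.
From Stdlib Require Import Reals.

Set Implicit Arguments.
Unset Strict Implicit.
Unset Printing Implicit Defensive.

Record group := Group {
  gcar :> Type;
  gmul : gcar -> gcar -> gcar;
  gone : gcar;
  ginv : gcar -> gcar;
  gmulA : forall x y z, gmul x (gmul y z) = gmul (gmul x y) z;
  gmul1 : forall x, gmul gone x = x;
  gmulV : forall x, gmul (ginv x) x = gone
}.

Section GroupDefs.
Variable G : group.

Local Notation "x * y" := (gmul x y).
Local Notation e := (gone G).

Definition gpow (f : G) (k : int) : G :=
  match k with
  | Posz n => iter n (gmul f) e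
  | Negz n => iter n.+1 (gmul (ginv f)) e
  end.

Definition translate (t : G) (H : G -> Prop) : G -> Prop :=
  fun x => exists2 h, H h & x = t * h.

Variable S : seq G.

Definition letter := ('I_(size S) * bool)%type.

Definition eval_letter (l : letter) : G :=
  if l.2 then nth e S l.1 else ginv (nth e S l.1).

Definition eval_word (w : seq letter) : G :=
  foldr (fun l acc => eval_letter l * acc) e w.

Definition generates : Prop :=
  forall g : G, exists w : seq letter, eval_word w = g.

Definition word_of_length (x y : G) (n : nat) : bool :=
  `[< exists w : seq letter, size w = n /\ x * eval_word w = y >].

(* word metric d(x,y) = least length of a word w with x w = y
   (0 by convention if there is none; never happens when S generates) *)
Definition dist (x y : G) : nat :=
  match pselect (exists n, word_of_length x y n) with
  | left h => ex_minn h
  | right _ => 0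
  end.

Definition nbhd (r : R) (A : G -> Prop) : G -> Prop :=
  fun x => exists2 a, A a & (INR (dist x a) <= r)%R.

Definition diam_le (A : G -> Prop) (b : R) : Prop :=
  forall x y, A x -> A y -> (INR (dist x y) <= b)%R.
Definition diam_lt (A : G -> Prop) (b : R) : Prop :=
  forall x y, A x -> A y -> (INR (dist x y) < b)%R.

Definition geodesic_seg (gam : nat -> G) (L : nat) : Prop :=
  forall i j, i <= L -> j <= L -> dist (gam i) (gam j) = `|i - j|%N.

Definition geodesic_between (x y : G) (gam : nat -> G) (L : nat) : Prop :=
  [/\ geodesic_seg gam L, gam 0 = x & gam L = y].

Definition seg_points (gam : nat -> G) (L : nat) : G -> Prop :=
  fun x => exists2 i, i <= L & x = gam i.

Definition geodesic_line (gam : int -> G) : Prop :=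
  forall i j : int, dist (gam i) (gam j) = `|i - j|%N.

Definition line_points (gam : int -> G) : G -> Prop :=
  fun x => exists i, x = gam i.

Definition proj (A : G -> Prop) (y : G) : G -> Prop :=
  fun a => A a /\ forall a', A a' -> dist y a <= dist y a'.

Definition proj_set (A : G -> Prop) (Y : G -> Prop) : G -> Prop :=
  fun a => exists2 y, Y y & proj A y a.

(* d(A,B) > D, the distance being an infimum of nat values *)
Definition setdist_gt (A B : G -> Prop) (D : R) : Prop :=
  forall a b, A a -> B b -> (D < INR (dist a b))%R.

Definition contracting_line (D : R) (gam : int -> G) : Prop :=
  geodesic_line gam /\
  forall (kap : nat -> G) (L : nat), geodesic_seg kap L ->
    setdist_gt (line_points gam) (seg_points kap L) D ->
    diam_lt (proj_set (line_points gam) (seg_points kap L)) D.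

Definition hausdorff_close (f : G) (gam : int -> G) : Prop :=
  exists M : nat,
    (forall i : int, exists j : int, dist (gpow f i) (gam j) <= M) /\
    (forall j : int, exists i : int, dist (gam j) (gpow f i) <= M).

Definition contracting_axis (D : R) (f : G) (gam : int -> G) : Prop :=
  contracting_line D gam /\ hausdorff_close f gam.

Definition strongly_independent (gam : int -> G) (H : G -> Prop) : Prop :=
  exists B : R, forall t : G,
    diam_le (proj_set (line_points gam) (translate t H)) B.

Definition coarsely_geod_connected (H : G -> Prop) : Prop :=
  exists r : R, (0 < r)%R /\
    forall x y, H x -> H y ->
      exists (gam : nat -> G) (L : nat),
        geodesic_between x y gam L /\
        forall i, i <= L -> nbhd r H (gam i).

Definition infinite_diam (H : G -> Prop) : Prop :=
  forall b : R, ~ diam_le H b.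

Definition virtually_cyclic : Prop :=
  exists (z : G) (F : seq G),
    forall g : G, exists2 f, List.In f F & exists k, g = f * gpow z k.

Definition excursion_value (H : G -> Prop) (K : R) (g : G) (m : nat) : Prop :=
  exists (gam : nat -> G) (L : nat) (t : G) (i j : nat),
    [/\ geodesic_between e g gam L, i <= L /\ j <= L,
        nbhd K (translate t H) (gam i), nbhd K (translate t H) (gam j)
      & dist (gam i) (gam j) = m].

(* E_{H,K}(g) = max over geodesics gam from e to g and t in G of
   diam(gam ∩ N_K(tH)); all such values are <= d(e,g), so the max is
   attained among m <= d(e,g). *)
Definition excursion (H : G -> Prop) (K : R) (g : G) : nat :=
  \max_(m < (dist e g).+1 | `[< excursion_value H K g m >]) m.

Definition words_upto (n : nat) : seq (seq letter) :=
  flatten [seq [seq val w | w <- enum {: k.-tuple letter}] | k <- iota 0 n.+1].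

Definition ball (n : nat) : seq {classic G} :=
  undup [seq (eval_word w : {classic G}) | w <- words_upto n].

Definition Pn (n : nat) (A : G -> Prop) : R :=
  (INR (count (fun g : {classic G} => `[< A g >]) (ball n))
   / INR (size (ball n)))%R.

End GroupDefs.

(* Main.v *)
(* Let X be the group of powers of the contracting element.  A geodesic whose endpoints project
   far apart on a translate pX passes near both projections.  As G is not virtually cyclic, some
   translate gX has bounded projection on X, so any x, y can be joined by a word a phi b^-1, with
   phi a long fixed element of X and a, b short, such that geodesics to x (a phi b^-1) y pass near
   x.  Hence the sphere sizes satisfy s_m s_n <= C s_(m+n).

   Suppose a family of elements is closed under cutting geodesics, and a fixed kind of word can be
   inserted at any of the m+1 places of a member of length m in such a way that the result
   determines the place up to W choices.  Then the family has proportion O(W/m) in the sphere of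
   radius m; since its members factor through spheres of fixed radius, once that proportion is
   below 1/(2C) it decays exponentially.

   Upper bound: by strong independence, geodesics staying close to a coset of H do not follow
   translates of X for long, and inserting a long power locates itself in such elements.  So the
   chords of cosets of H are exponentially rare, and an excursion of length at least C2 log n has
   probability at most a power of n.  Lower bound: for elements without excursions of length
   T = C1 log n, insert a chord of H slightly longer than T between two long powers; the place is
   then determined up to O(T) choices, at the price of a factor exp(O(T)) = n^epsilon. *)
Require Import Defs.
From HB Require Import structures.
From mathcomp Require Import all_boot all_order all_algebra.
From mathcomp Require Import boolp.
From mathcomp Require Import zify.

Set Implicit Arguments.
Unset Strict Implicit.
Unset Printing Implicit Defensive.

Section GroupLaws.
Variable G : group.
Local Notation "x * y" := (gmul x y).
Local Notation e := (gone G).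
Implicit Types x y z : G.

Lemma gmulK x y : ginv x * (x * y) = y.
Proof. by rewrite gmulA gmulV gmul1. Qed.

Lemma gmulI x y z : x * y = x * z -> y = z.
Proof. by move=> h; rewrite -(gmulK x y) h gmulK. Qed.

Lemma gmulrV x : x * ginv x = e.
Proof.
by rewrite -[LHS]gmul1 -{1}(gmulV (ginv x)) -gmulA (gmulK x) gmulV.
Qed.

Lemma gmulr1 x : x * e = x.
Proof. by rewrite -(gmulV x) gmulA gmulrV gmul1. Qed.

Lemma gmulKV x y : x * (ginv x * y) = y.
Proof. by rewrite gmulA gmulrV gmul1. Qed.

Lemma ginvK x : ginv (ginv x) = x.
Proof. by apply: (@gmulI (ginv x)); rewrite gmulrV gmulV. Qed.

Lemma ginvM x y : ginv (x * y) = ginv y * ginv x.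
Proof. by apply: (@gmulI (x * y)); rewrite gmulrV -gmulA gmulKV gmulrV. Qed.

Lemma ginv1 : ginv e = e.
Proof. by rewrite -[LHS]gmulr1 gmulV. Qed.

Lemma ginv_eq x y : x * y = e -> ginv x = y.
Proof. by move=> h; apply: (@gmulI x); rewrite gmulrV h. Qed.

Lemma gmulAr x y z : (x * y) * z = x * (y * z).
Proof. by rewrite gmulA. Qed.

Definition gE := (gmulAr, gmul1, gmulr1, gmulV, gmulrV, gmulK, gmulKV, ginvM, ginvK, ginv1).

End GroupLaws.

Section WordMetric.
Variables (G : group) (S : seq G).
Hypothesis gen : generates S.
Local Notation "x * y" := (gmul x y).
Local Notation e := (gone G).
Local Notation d := (Defs.dist S).
Local Notation ev := (@eval_word G S).
Implicit Types x y z t : G.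

Lemma eval_word_cat u v : ev (u ++ v) = ev u * ev v.
Proof. by elim: u => [|l u IH] /=; rewrite ?gmul1 // IH gmulA. Qed.

Definition inv_word (w : seq (letter S)) : seq (letter S) :=
  rev [seq (l.1, ~~ l.2) | l <- w].

Lemma size_inv_word w : size (inv_word w) = size w.
Proof. by rewrite size_rev size_map. Qed.

Lemma eval_inv_word w : ev (inv_word w) = ginv (ev w).
Proof.
elim: w => [|[i b] w IH]; first by rewrite /= ginv1.
rewrite /inv_word /= rev_cons -cats1 eval_word_cat -/(inv_word w) IH /= gmulr1 ginvM.
by congr (_ * _); rewrite /eval_letter /=; case: b; rewrite //= ginvK.
Qed.

Lemma dist_word x y : exists w, size w = d x y /\ x * ev w = y.
Proof.
rewrite /Defs.dist; case: pselect => [h|[]]; first by case: ex_minnP => m /asboolP.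
have [w hw] := gen (ginv x * y).
by exists (size w); apply/asboolP; exists w; split=> //; rewrite hw gmulKV.
Qed.

Lemma dist_le_word x w : d x (x * ev w) <= size w.
Proof.
rewrite /Defs.dist; case: pselect => [h|//]; case: ex_minnP => m _; apply.
by apply/asboolP; exists w.
Qed.

Lemma dist_le x y w : x * ev w = y -> d x y <= size w.
Proof. by move <-; apply: dist_le_word. Qed.

Lemma dist0 x : d x x = 0.
Proof. by apply/eqP; rewrite -leqn0; apply: (@dist_le x x [::]); rewrite /= gmulr1. Qed.

Lemma dist_eq0 x y : d x y = 0 -> x = y.
Proof. by have [w [<- <-]] := dist_word x y; case: w => //= _; rewrite gmulr1. Qed.

Lemma dist_triangle x y z : d x z <= d x y + d y z.
Proof.
have [u [<- hu]] := dist_word x y; have [v [<- hv]] := dist_word y z.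
by rewrite -size_cat; apply: dist_le; rewrite eval_word_cat gmulA hu.
Qed.

Lemma dist_leC x y : d x y <= d y x.
Proof.
have [u [<- hu]] := dist_word y x; rewrite -size_inv_word; apply: dist_le.
by rewrite eval_inv_word -hu !gE.
Qed.

Lemma distC x y : d x y = d y x.
Proof. by apply/eqP; rewrite eqn_leq !dist_leC. Qed.

Lemma dist_mull_le t x y : d (t * x) (t * y) <= d x y.
Proof. by have [u [<- hu]] := dist_word x y; apply: dist_le; rewrite -hu gmulA. Qed.

Lemma dist_mull t x y : d (t * x) (t * y) = d x y.
Proof.
apply/eqP; rewrite eqn_leq dist_mull_le /=.
by rewrite -{1}(gmulK t x) -{1}(gmulK t y) dist_mull_le.
Qed.

Lemma dist_mulr x y : d x (x * y) = d e y.
Proof. by rewrite -{1}(gmulr1 x) dist_mull. Qed.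

Lemma dist_mulVl x y t : d (ginv t * x) y = d x (t * y).
Proof. by rewrite -(dist_mull t) gmulKV. Qed.

Lemma len_inv x : d e (ginv x) = d e x.
Proof. by rewrite -(dist_mull x) gmulrV gmulr1 distC. Qed.

Lemma dist_len x y : d x y = d e (ginv x * y).
Proof. by rewrite -(dist_mull x e) gmulr1 gmulKV. Qed.

Lemma lenM x y : d e (x * y) <= d e x + d e y.
Proof. by rewrite -(dist_mulr x y) dist_triangle. Qed.

Lemma geodesic_between_len x y k L : geodesic_between S x y k L -> L = d x y.
Proof. by case=> hk <- <-; rewrite hk //; lia. Qed.

Lemma geodesic_exists x y : exists k, geodesic_between S x y k (d x y).
Proof.
have [w [hs hw]] := dist_word x y.
have hfull : x * ev (take (d x y) w) = y by rewrite -hs take_size.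
exists (fun i => x * ev (take i w)); split; last 2 first.
- by rewrite take0 /= gmulr1.
- exact: hfull.
have sub i j : i <= j -> j <= d x y -> d (x * ev (take i w)) (x * ev (take j w)) <= j - i.
  move=> ij jL; rewrite -{1}(cat_take_drop i (take j w)) take_takel // eval_word_cat.
  rewrite gmulA; apply: leq_trans (dist_le_word _ _) _.
  by rewrite size_drop size_takel // hs.
have eq i j : i <= j -> j <= d x y -> d (x * ev (take i w)) (x * ev (take j w)) = j - i.
  move=> ij jL; apply/eqP; rewrite eqn_leq sub //=.
  have h1 := sub 0 i isT (leq_trans ij jL); have h2 := sub j (d x y) jL (leqnn _).
  rewrite take0 /= gmulr1 in h1; rewrite hfull in h2.
  have := dist_triangle x (x * ev (take i w)) y.
  have := dist_triangle (x * ev (take i w)) (x * ev (take j w)) y; lia.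
move=> i j iL jL; case: (leqP i j) => ij; first by rewrite eq //; lia.
by rewrite distC eq //; lia.
Qed.

Lemma geodesic_sub k L i j : geodesic_seg S k L -> i <= j -> j <= L ->
  geodesic_between S (k i) (k j) (fun n => k (i + n)) (j - i).
Proof.
move=> hk ij jL; split; last 2 first.
- by rewrite addn0.
- by congr k; lia.
by move=> m n hm hn; rewrite hk; lia.
Qed.

Lemma geodesic_mull t k L x y : geodesic_between S x y k L ->
  geodesic_between S (t * x) (t * y) (fun n => t * k n) L.
Proof. by case=> hk <- <-; split=> // i j iL jL; rewrite dist_mull hk. Qed.

Lemma geodesic_dist k L i j : geodesic_seg S k L -> i <= j -> j <= L -> d (k i) (k j) = j - i.
Proof. by move=> hk ij jL; rewrite hk; lia. Qed.

Lemma geodesic_cat x y z k1 L1 k2 L2 : geodesic_between S x y k1 L1 ->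
  geodesic_between S y z k2 L2 -> L1 + L2 = d x z ->
  geodesic_between S x z (fun n => if n <= L1 then k1 n else k2 (n - L1)) (L1 + L2).
Proof.
move=> [h1 h10 h1L] [h2 h20 h2L] hL.
have e1 i j : i <= j -> j <= L1 -> d (k1 i) (k1 j) = j - i by apply: geodesic_dist.
have e2 i j : i <= j -> j <= L2 -> d (k2 i) (k2 j) = j - i by apply: geodesic_dist.
have e3 i j : i <= L1 -> j <= L2 -> d (k1 i) (k2 j) = L1 - i + j.
  move=> iL jL.
  have a1 := e1 0 i isT iL; have a2 := e1 i L1 iL (leqnn _).
  have a3 := e2 0 j isT jL; have a4 := e2 j L2 jL (leqnn _).
  rewrite h10 in a1; rewrite h1L in a2; rewrite h20 in a3; rewrite h2L in a4.
  have b1 := dist_triangle (k1 i) y (k2 j).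
  have b2 := dist_triangle x (k1 i) z; have b3 := dist_triangle (k1 i) (k2 j) z; lia.
have mono i j : i <= j -> j <= L1 + L2 ->
    d (if i <= L1 then k1 i else k2 (i - L1)) (if j <= L1 then k1 j else k2 (j - L1)) = j - i.
  move=> ij jL; case: (leqP i L1) => iL; case: (leqP j L1) => jL1; try by exfalso; lia.
  - exact: e1.
  - by rewrite e3; lia.
  - by rewrite e2; lia.
split.
- move=> i j iL jL; case: (leqP i j) => ij; first by rewrite mono //; lia.
  by rewrite distC mono //; lia.
- by rewrite leq0n.
- case: leqP => h; last by rewrite addKn.
  have -> : L2 = 0 by lia.
  by rewrite addn0 h1L -h20 -h2L; congr k2; lia.
Qed.

End WordMetric.

(** * Contracting sets *)

Section Contracting.
Variables (G : group) (S : seq G).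
Hypothesis gen : generates S.
Local Notation "x * y" := (gmul x y).
Local Notation e := (gone G).
Local Notation d := (Defs.dist S).
Local Notation geod := (geodesic_between S).
Local Notation tri := (dist_triangle gen).
Local Notation dC := (distC gen).
Implicit Types (x y z a b p : G) (X : G -> Prop).

Lemma proj_exists X x z : X x -> exists a, proj S X z a.
Proof.
move=> Xx.
have ex : exists n, `[< exists2 a, X a & d z a = n >] by exists (d z x); apply/asboolP; exists x.
case: (ex_minnP ex) => n /asboolP [a Xa <-] min; exists a; split=> // b Xb.
by apply: min; apply/asboolP; exists b.
Qed.

Lemma proj_along X z w k L i : proj S X z w -> geod z w k L -> i <= L -> proj S X (k i) w.
Proof.
case=> Xw min gk iL; split=> // a Xa; case: (gk) => hk k0 kL.
have h1 := geodesic_dist hk (leq0n i) iL; have h2 := geodesic_dist hk iL (leqnn L).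
have h3 := geodesic_dist hk (leq0n L) (leqnn L).
rewrite k0 in h1 h3; rewrite kL in h2 h3.
have := min a Xa; have := tri z (k i) a; lia.
Qed.

Definition contracting X (D : nat) :=
  forall k L, geodesic_seg S k L -> (forall i x, i <= L -> X x -> D < d (k i) x) ->
  forall i j a b, i <= L -> j <= L -> proj S X (k i) a -> proj S X (k j) b -> d a b <= D.

Variables (X : G -> Prop) (D : nat).
Hypothesis contrX : contracting X D.
Local Notation E := (2 * D + 2)%N.

(* Before first entering the D-neighbourhood of X a geodesic projects to a set of
   diameter at most D, and symmetrically after last leaving it. *)
Lemma geodesic_visits_proj k L a b : geodesic_seg S k L ->
  proj S X (k 0) a -> proj S X (k L) b -> D < d a b ->
  exists i j, [/\ i <= j, j <= L, d (k i) a <= E & d (k j) b <= E].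
Proof.
move=> hk pa pb Dab.
pose P := fun i => (i <= L) && `[< exists2 x, X x & d (k i) x <= D >].
have exP : exists i, P i.
  apply: contrapT => /forallNP nP.
  suff : d a b <= D by lia.
  apply: (contrX hk _ (leq0n L) (leqnn L) pa pb) => i x iL Xx.
  by rewrite ltnNge; apply/negP => le; apply: (nP i); rewrite /P iL; apply/asboolP; exists x.
have bP i : P i -> i <= L by case/andP.
case: (ex_minnP exP) => i /andP [iL /asboolP [x Xx dx]] mini.
case: (ex_maxnP exP bP) => j /andP [jL /asboolP [y Xy dy]] maxj.
exists i, j; split=> //.
- by apply: mini; rewrite /P jL; apply/asboolP; exists y.
- case: i iL dx mini => [_ dx _|i iL dx mini]; first by have := pa.2 x Xx; lia.
  have [a' pa'] := proj_exists (k i) Xx.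
  have h1 := pa'.2 x Xx; have h2 := geodesic_dist hk (leqnSn i) iL.
  suff : d a a' <= D.
    have := tri (k i) (k i.+1) x; have := tri (k i.+1) (k i) a; have := tri (k i) a' a.
    by rewrite (dC (k i.+1) (k i)) (dC a' a); lia.
  have [hk' k'0 k'i] := geodesic_sub hk (leq0n i) (ltnW iL).
  rewrite subn0 in hk' k'i.
  apply: (contrX hk' _ (leq0n i) (leqnn i)); rewrite ?add0n // => m z mi Xz.
  rewrite ltnNge; apply/negP => le.
  have : P m by apply/andP; split; [lia|apply/asboolP; exists z].
  by move/mini; lia.
- case: (ltngtP j L) => jL'; [|lia|]; last first.
    by rewrite jL' in dy *; have := pb.2 y Xy; lia.
  have [b' pb'] := proj_exists (k j.+1) Xy.
  have h1 := pb'.2 y Xy; have h2 := geodesic_dist hk (leqnSn j) jL'.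
  suff : d b b' <= D.
    have := tri (k j.+1) (k j) y; have := tri (k j) (k j.+1) b; have := tri (k j.+1) b' b.
    by rewrite (dC (k j.+1) (k j)) (dC b' b); lia.
  have [hk' k'0 k'i] := geodesic_sub hk jL' (leqnn L).
  rewrite dC; apply: (contrX hk' _ (leq0n _) (leqnn _)); rewrite ?k'0 ?k'i // => m z mi Xz.
  rewrite ltnNge; apply/negP => le.
  have : P (j.+1 + m)%N by apply/andP; split; [lia|apply/asboolP; exists z].
  by move/maxj; lia.
Qed.

Lemma proj_lipschitz z w a b : proj S X z a -> proj S X w b -> d a b <= d z w + 2 * E.
Proof.
move=> pa pb; case: (leqP (d a b) D) => h; first lia.
have [k [hk k0 kL]] := geodesic_exists gen z w.
rewrite -k0 in pa; rewrite -kL in pb.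
have [i [j [ij jL hi hj]]] := geodesic_visits_proj hk pa pb h.
have := geodesic_dist hk ij jL.
have := tri a (k i) b; have := tri (k i) (k j) b; rewrite (dC a (k i)); lia.
Qed.

(* A projection of an interior point q is visited on both sides of q, so q is trapped. *)
Lemma geodesic_near x y k L i : X x -> X y -> geod x y k L -> i <= L ->
  exists2 w, X w & d (k i) w <= 3 * E.
Proof.
move=> Xx Xy [hk k0 kL] iL.
have [w pw] := proj_exists (k i) Xx; exists w; first exact: pw.1.
have px : proj S X (k 0) x by rewrite k0; split=> // a _; rewrite dist0.
have py : proj S X (k (i + (L - i))) y by rewrite subnKC // kL; split=> // a _; rewrite dist0.
have left : exists2 j, j <= i & d (k j) w <= E.
  case: (leqP (d x w) D) => h; first by exists 0; rewrite ?k0; lia.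
  have [hk' k'0 k'i] := geodesic_sub hk (leq0n i) iL; rewrite subn0 in hk' k'i.
  have [j [j' [jj' j'i _ hj']]] := geodesic_visits_proj hk' px pw h.
  by exists j'; rewrite add0n in hj' *.
have right : exists2 j, i <= j <= L & d (k j) w <= E.
  case: (leqP (d w y) D) => h; first by exists L; rewrite ?kL ?(dC y); lia.
  have [hk' k'0 k'i] := geodesic_sub hk iL (leqnn L).
  rewrite -k'0 in pw.
  have [j [j' [jj' j'i hj _]]] := geodesic_visits_proj hk' pw py h.
  by exists (i + j)%N => //; lia.
case: left => j ji hj; case: right => j' /andP [ij' j'L] hj'.
have h1 := geodesic_dist hk (leq_trans ji ij') j'L.
have h2 := geodesic_dist hk ji iL.
have := tri (k j) w (k j'); have := tri (k i) (k j) w.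
rewrite (dC w) (dC (k i) (k j)); lia.
Qed.

Section HausdorffClose.
Variables (Y : G -> Prop) (M : nat).
Hypothesis XY : forall x, X x -> exists2 y, Y y & d x y <= M.
Hypothesis YX : forall y, Y y -> exists2 x, X x & d y x <= M.

Lemma proj_hausdorff z a b : proj S X z a -> proj S Y z b -> d a b <= 2 * E + M.
Proof.
move=> pa pb.
have [b' Xb' hb'] := YX pb.1.
have [a2 pa2] := proj_exists b Xb'; have ha2 := pa2.2 b' Xb'.
case: (leqP (d a a2) D) => h; first by have := tri a a2 b; rewrite (dC a2 b); lia.
have [k gk] := geodesic_exists gen z b; case: (gk) => hk k0 kL.
rewrite -k0 in pa; rewrite -kL in pa2.
have [i [j [ij jL hi _]]] := geodesic_visits_proj hk pa pa2 h.
have [y Yy hy] := XY pa.1.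
have := (proj_along pb gk (leq_trans ij jL)).2 y Yy.
have := tri (k i) a y; have := tri a (k i) b; rewrite (dC a (k i)); lia.
Qed.

Lemma contracting_hausdorff x : X x -> contracting Y (D + M + 2 * (2 * E + M))%N.
Proof.
move=> Xx k L hk far i j a b iL jL pa pb.
have [a' pa'] := proj_exists (k i) Xx; have [b' pb'] := proj_exists (k j) Xx.
have ha := proj_hausdorff pa' pa; have hb := proj_hausdorff pb' pb.
suff : d a' b' <= D.
  have := tri a a' b; have := tri a' b' b; rewrite (dC a a'); lia.
apply: (contrX hk _ iL jL pa' pb') => m z mL Xz.
have [y Yy hy] := XY Xz; have := far m y mL Yy; have := tri (k m) z y; lia.
Qed.
End HausdorffClose.

End Contracting.

Section Balls.
Variables (G : group) (S : seq G).
Hypothesis gen : generates S.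
Local Notation e := (gone G).
Local Notation d := (Defs.dist S).

Lemma mem_ball n (g : {classic G}) : (g \in ball S n) = (d e g <= n).
Proof.
rewrite mem_undup; apply/mapP/idP => [[w + ->]|h].
  move=> /flatten_mapP [k]; rewrite mem_iota add0n ltnS => /andP [_ kn] /mapP [t _ ->].
  by apply: leq_trans kn; rewrite -[in leqRHS](size_tuple t); apply: dist_le; rewrite gmul1.
have [w [hs hw]] := dist_word gen e g; exists w; last by rewrite -hw gmul1.
apply/flatten_mapP; exists (size w); first by rewrite mem_iota add0n ltnS hs h.
by apply/mapP; exists (in_tuple w); rewrite ?mem_enum.
Qed.

Lemma ball_uniq n : uniq (ball S n).
Proof. exact: undup_uniq. Qed.

End Balls.

Lemma mem_In (T : eqType) (x : T) s : x \in s -> List.In x s.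
Proof.
by elim: s => //= y s IH; rewrite inE => /orP [/eqP -> |/IH]; [left|right].
Qed.

(** * Translates of the axis *)

Section Powers.
Variable G : group.
Local Notation "x * y" := (gmul x y).
Local Notation e := (gone G).
Implicit Types (f x y u : G) (i j : int).

Lemma gpow_succ f i : gpow f (i + 1)%R = f * gpow f i.
Proof.
case: i => [n|[|n]].
- by have -> : (Posz n + 1)%R = Posz n.+1 by lia.
- by rewrite /= gmulr1 gmulrV.
- have -> : (Negz n.+1 + 1)%R = Negz n by lia.
  by rewrite /= gmulKV.
Qed.

Lemma gpow_pred f i : gpow f (i - 1)%R = ginv f * gpow f i.
Proof. by rewrite -{2}(GRing.subrK 1%R i) gpow_succ gmulK. Qed.

Lemma int_step_ind (P : int -> Prop) : P 0%R ->
  (forall i, P i -> P (i + 1)%R) -> (forall i, P i -> P (i - 1)%R) -> forall i, P i.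
Proof.
move=> P0 PS PP; case=> n; elim: n => [|n IH] //.
- have -> : Posz n.+1 = (Posz n + 1)%R by lia.
  exact: PS.
- exact: (PP 0%R).
- have -> : Negz n.+1 = (Negz n - 1)%R by lia.
  exact: PP.
Qed.

Lemma gpowD f i j : gpow f (i + j)%R = gpow f i * gpow f j.
Proof.
elim/int_step_ind: i => [|i IH|i IH]; first by rewrite GRing.add0r gmul1.
- have -> : (i + 1 + j)%R = (i + j + 1)%R by lia.
  by rewrite !gpow_succ IH gmulA.
- have -> : (i - 1 + j)%R = (i + j - 1)%R by lia.
  by rewrite !gpow_pred IH gmulA.
Qed.

Lemma gpowN f i : gpow f (- i)%R = ginv (gpow f i).
Proof. by symmetry; apply: ginv_eq; rewrite -gpowD GRing.subrr. Qed.

Lemma gpowM f i j : gpow f (i * j)%R = gpow (gpow f i) j.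
Proof.
elim/int_step_ind: j => [|j IH|j IH]; first by rewrite GRing.mulr0.
- by rewrite (_ : (i * (j + 1))%R = (i + i * j)%R) ?gpow_succ ?gpowD ?IH //; lia.
- by rewrite (_ : (i * (j - 1))%R = (- i + i * j)%R) ?gpow_pred ?gpowD ?IH ?gpowN //; lia.
Qed.

Lemma gpow_conj x y u j : x * u = u * y -> gpow x j * u = u * gpow y j.
Proof.
move=> h; elim/int_step_ind: j => [|j IH|j IH]; first by rewrite gmul1 gmulr1.
- by rewrite !gpow_succ gmulAr IH gmulA h gmulAr.
- rewrite !gpow_pred gmulAr IH; apply: (@gmulI _ x).
  by rewrite gmulKV gmulA h gmulAr gmulKV.
Qed.

Definition powers f : G -> Prop := fun x => exists k, x = gpow f k.

Lemma powersM f x y : powers f x -> powers f y -> powers f (x * y).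
Proof. by move=> [i ->] [j ->]; exists (i + j)%R; rewrite gpowD. Qed.

Lemma powersV f x : powers f x -> powers f (ginv x).
Proof. by move=> [i ->]; exists (- i)%R; rewrite gpowN. Qed.

Lemma powers1 f : powers f e.
Proof. by exists 0%R. Qed.

End Powers.

Section Independent.
Variables (G : group) (S : seq G).
Hypothesis gen : generates S.
Local Notation "x * y" := (gmul x y).
Local Notation e := (gone G).
Local Notation d := (Defs.dist S).
Local Notation tri := (dist_triangle gen).
Local Notation dC := (distC gen).
Variables (f : G) (D : nat).
Local Notation X := (powers f).
Hypothesis contrX : contracting S X D.
Local Notation E := (2 * D + 2)%N.

Section Unbounded.
Hypothesis unb : forall g B, exists x a, [/\ X x, proj S X (g * x) a & B < d e a].

Lemma coset_fellow_travels g R : exists i j u,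
  [/\ d e u <= 4 * E, g * gpow f i = gpow f j * u & R <= d e (gpow f j)].
Proof.
have [a0 pa0] := proj_exists S g (powers1 f).
have [x [a [Xx pa la]]] := unb g (R + d e a0 + D).
have h : D < d a0 a by have := tri e a0 a; lia.
have [k gk] := geodesic_exists gen g (g * x); case: (gk) => hk k0 kL.
rewrite -k0 in pa0; rewrite -kL in pa.
have [_ [j [_ jL _ hj]]] := geodesic_visits_proj gen contrX hk pa0 pa h.
have gk' := geodesic_mull gen (ginv g) gk; rewrite gmulV gmulK in gk'.
have [w [i wi] hw] := geodesic_near gen contrX (powers1 f) Xx gk' jL.
case: (pa.1) => m am; exists i, m, (ginv a * (g * w)); split.
- rewrite -dist_len //; rewrite dist_mulVl // in hw.
  have := tri a (k j) (g * w); rewrite (dC a (k j)); lia.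
- by rewrite -am gmulKV wi.
- by rewrite -am; lia.
Qed.

Lemma commensurating u0 : exists m m', (0 < m)%N /\ gpow f (Posz m) * u0 = u0 * gpow f m'.
Proof.
suff [m [m' [nz h]]] : exists m m', m != 0%R /\ gpow f m * u0 = u0 * gpow f m'.
  have [hm|hm] : (0 < m)%R \/ (m < 0)%R by lia.
    by exists `|m|%N, m'; split; [lia|rewrite gez0_abs //; lia].
  exists `|m|%N, (- m')%R; split; first lia.
  rewrite lez0_abs; last lia.
  rewrite !gpowN; apply: (@gmulI _ (gpow f m)).
  by rewrite gmulKV gmulA h gmulAr gmulrV gmulr1.
apply: contrapT => noconj.
have bnd (u : G) : exists R, forall i j, u0 * gpow f i = gpow f j * u -> d e (gpow f j) <= R.
  case: (pselect (exists i j, u0 * gpow f i = gpow f j * u)) => [[i [j h]]|no]; last first.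
    by exists 0 => i j h; case: no; exists i, j.
  exists (d e (gpow f j)) => i' j' h'; case: (eqVneq j j') => [-> //|nj].
  case: noconj; exists (j' - j)%R, (i' - i)%R; split; first lia.
  rewrite !gpowD !gpowN gmulA h'.
  have hu : u = ginv (gpow f j) * (u0 * gpow f i) by rewrite h gmulK.
  by rewrite hu !gE.
have [Rf hR] := choice bnd.
have [i [j [u [lu h hj]]]] := coset_fellow_travels u0 (\max_(v <- ball S (4 * E)) Rf v).+1.
have := hR u i j h.
have : Rf u <= \max_(v <- ball S (4 * E)) Rf v.
  apply: (@leq_bigmax_seq _ (ball S (4 * E)) predT Rf (u : {classic G})) => //.
  by rewrite mem_ball.
lia.
Qed.

Lemma unbounded_virtually_cyclic : virtually_cyclic G.
Proof.
have [m hm] := choice commensurating.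
pose coset_reps (u : {classic G}) : seq {classic G} :=
  [seq (gpow f (Posz r) * u : {classic G}) | r <- iota 0 (m u)].
exists f, (flatten (map coset_reps (ball S (4 * E)))) => g.
have [i [j [u [lu h _]]]] := coset_fellow_travels g 0.
have [m' [m0 hm']] := hm u.
exists (gpow f (j %% m u)%Z * u).
  apply: (@mem_In {classic G}); apply/(@flatten_mapP {classic G} {classic G}).
  exists (u : {classic G}); first by rewrite mem_ball.
  apply/mapP; exists `|(j %% m u)%Z|%N; last by rewrite gez0_abs // modz_ge0; lia.
  rewrite mem_iota add0n.
  have := @ltz_pmod j (m u); have := @modz_ge0 j (m u); lia.
exists (m' * (j %/ m u)%Z - i)%R.
have hj : gpow f j = gpow f (j %% m u)%Z * gpow (gpow f (m u)) (j %/ m u)%Z.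
  by rewrite -gpowM -gpowD {1}(divz_eq j (m u)); congr gpow; lia.
have hu : u = ginv (gpow f j) * (g * gpow f i) by rewrite h gmulK.
rewrite (gpowD f (m' * _)%R) gpowM gpowN gmulA (gmulAr _ u) -(gpow_conj _ hm') gmulA -hj.
by rewrite -h gmulAr gmulrV gmulr1.
Qed.
End Unbounded.

(* If z projects far from e on X, every geodesic from z to a point of gX passes near e,
   in particular the one from z to its projection on gX. *)
Lemma projection_dichotomy g B :
  (forall x a, X x -> proj S X (g * x) a -> d e a <= B) ->
  exists c t, forall z, exists a, d e a <= c /\
    forall w, proj S X (ginv a * z) w -> d e w <= t.
Proof.
move=> hB; exists (d e g), (B + D + 2 * (E + B + d e g))%N => z.
case: (pselect (forall w, proj S X z w -> d e w <= B + D)) => [h|].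
  exists e; rewrite (dist0 S); split=> // w; rewrite ginv1 gmul1 => /h; lia.
move/existsNP => [w0 /not_implyP [pw0 far]]; exists g; split=> // w pw.
have [a pa] := proj_exists S (g * w) pw.1.
have la := hB _ _ pw.1 pa.
have Dd : D < d w0 a by have := tri e a w0; rewrite (dC w0 a); lia.
have [k gk] := geodesic_exists gen z (g * w); case: (gk) => hk k0 kL.
rewrite -k0 in pw0; rewrite -kL in pa.
have [_ [j [_ jL _ hj]]] := geodesic_visits_proj gen contrX hk pw0 pa Dd.
have gk' := geodesic_mull gen (ginv g) gk; rewrite gmulK in gk'.
have pj := proj_along gen pw gk' jL.
have := pj.2 e (powers1 f).
have := tri e (ginv g * k j) w; rewrite (dC e (ginv g * _)) (dist_mulVl gen (k j) e g) gmulr1.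
have := tri (k j) a e; have := tri (k j) e g; rewrite (dC a e); lia.
Qed.

Lemma axis_choice : ~ virtually_cyclic G ->
  exists c t, forall z, exists a, d e a <= c /\
    forall w, proj S X (ginv a * z) w -> d e w <= t.
Proof.
move=> nvc; apply: contrapT => no; apply: nvc; apply: unbounded_virtually_cyclic => g B.
apply: contrapT => bd; apply: no; apply: (@projection_dichotomy g B) => x a Xx pa.
by rewrite leqNgt; apply/negP => h; apply: bd; exists x, a.
Qed.

End Independent.

(** * Concatenating along long powers *)

Section Junctions.
Variables (G : group) (S : seq G).
Hypothesis gen : generates S.
Local Notation "x * y" := (gmul x y).
Local Notation e := (gone G).
Local Notation d := (Defs.dist S).
Local Notation geod := (geodesic_between S).
Local Notation tri := (dist_triangle gen).
Local Notation dC := (distC gen).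
Implicit Types (x y z a b p h : G).

Variables (X : G -> Prop) (D c0 t0 : nat).
Hypothesis X1 : X e.
Hypothesis XM : forall x y, X x -> X y -> X (x * y).
Hypothesis XV : forall x, X x -> X (ginv x).
Hypothesis contrX : contracting S X D.
Hypothesis choiceX : forall z, exists a, d e a <= c0 /\
  forall w, proj S X (ginv a * z) w -> d e w <= t0.
Local Notation E := (2 * D + 2)%N.

(* The closest points to z on the translate pX lie within t of pv. *)
Definition projects_near p z v t := forall w, proj S X (ginv p * z) w -> d w v <= t.

Lemma projects_nearW p z v t t' : t <= t' -> projects_near p z v t -> projects_near p z v t'.
Proof. by move=> tt' h w /h; lia. Qed.

Lemma projects_near_close p z z' v t s : projects_near p z v t -> d z z' <= s ->
  projects_near p z' v (t + s + 2 * E).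
Proof.
move=> h hs w pw; have [w' pw'] := proj_exists S (ginv p * z) X1.
have := proj_lipschitz gen contrX pw' pw; rewrite dist_mull //.
have := h w' pw'; have := tri w w' v; rewrite (dC w w'); lia.
Qed.

Lemma crossing p z1 z2 w1 w2 k L : geod z1 z2 k L ->
  proj S X (ginv p * z1) w1 -> proj S X (ginv p * z2) w2 -> D < d w1 w2 ->
  exists i j, [/\ i <= j, j <= L, d (k i) (p * w1) <= E & d (k j) (p * w2) <= E].
Proof.
move=> gk p1 p2 h; have [hk k0 kL] := geodesic_mull gen (ginv p) gk.
rewrite -k0 in p1; rewrite -kL in p2.
have [i [j [ij jL hi hj]]] := geodesic_visits_proj gen contrX hk p1 p2 h.
by exists i, j; rewrite -!(dist_mulVl gen).
Qed.

Lemma crossing_near p z1 z2 v1 v2 t1 t2 k L : geod z1 z2 k L ->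
  projects_near p z1 v1 t1 -> projects_near p z2 v2 t2 -> D + t1 + t2 < d v1 v2 ->
  exists i j, [/\ i <= j, j <= L, d (k i) (p * v1) <= E + t1 & d (k j) (p * v2) <= E + t2].
Proof.
move=> gk h1 h2 h.
have [w1 pw1] := proj_exists S (ginv p * z1) X1; have [w2 pw2] := proj_exists S (ginv p * z2) X1.
have n1 := h1 _ pw1; have n2 := h2 _ pw2.
have [|i [j [ij jL hi hj]]] := crossing gk pw1 pw2.
  have := tri v1 w1 v2; have := tri w1 w2 v2; rewrite (dC v1 w1); lia.
exists i, j; split=> //.
- have := tri (k i) (p * w1) (p * v1); rewrite dist_mull //; lia.
- have := tri (k j) (p * w2) (p * v2); rewrite dist_mull //; lia.
Qed.

Lemma proj_mulX phi z w : X phi -> proj S X (phi * z) w -> proj S X z (ginv phi * w).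
Proof.
move=> Xp [Xw min]; split; first by apply: XM => //; apply: XV.
by move=> x Xx; rewrite dC dist_mulVl // dC -(dist_mull gen phi z x) min //; apply: XM.
Qed.

Definition connector a phi b := a * (phi * ginv b).

Lemma junction x y : exists a b, [/\ d e a <= c0, d e b <= c0,
  projects_near (x * a) e e t0 &
  forall phi, X phi -> projects_near (x * a) (x * (connector a phi b * y)) phi t0].
Proof.
have [a [la ha]] := choiceX (ginv x); have [b [lb hb]] := choiceX y.
exists a, b; split=> // [w|phi Xp w].
  by rewrite gmulr1 ginvM dC => /ha.
rewrite /connector !gE => /(proj_mulX Xp) /hb.
by rewrite -(dist_mull gen phi) gmulKV gmulr1 dC.
Qed.

Lemma connector_len a phi b : d e a <= c0 -> d e b <= c0 ->
  d e (connector a phi b) <= 2 * c0 + d e phi.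
Proof.
move=> la lb; have := lenM gen a (phi * ginv b); have := lenM gen phi (ginv b).
rewrite /connector len_inv //; lia.
Qed.

Lemma later_projection p phi al L i j k w s : geodesic_seg S al L ->
  i <= j -> j <= k -> k <= L -> X phi ->
  d (al i) p <= s -> d (al j) (p * phi) <= s -> proj S X (ginv p * al k) w ->
  d e phi <= d e w + 3 * s + D + E.
Proof.
move=> hal ij jk kL Xp hi hj pw.
have [v pv] := proj_exists S (ginv p * al j) X1.
have vphi : d v phi <= 2 * s.
  have hq : d (ginv p * al j) phi <= s by rewrite dist_mulVl.
  have := pv.2 phi Xp.
  have := tri v (ginv p * al j) phi; rewrite (dC v (ginv p * al j)); lia.
case: (leqP (d v w) D) => h.
  have := tri e w phi; have := tri w v phi; rewrite (dC w v); lia.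
have gs := geodesic_sub hal jk kL.
have [_ [j' [_ j'k _ hj']]] := crossing gs pv pw h.
have h1 := geodesic_dist hal (leq_addr j' j) (_ : j + j' <= L).
have h2 := geodesic_dist hal (leq_trans ij (leq_addr j' j)) (_ : j + j' <= L).
have h3 := geodesic_dist hal ij (leq_trans jk kL).
have h4 : j + j' <= L by lia.
have {h1 h4} h2 := h2 h4.
have := dist_mulr gen p phi; have := dist_mulr gen p w.
have := tri p (al i) (p * phi); have := tri (al i) (al j) (p * phi).
have := tri (al i) p (al (j + j')); have := tri p (p * w) (al (j + j')).
rewrite (dC p (al i)) (dC (p * w)); lia.
Qed.

(* A geodesic from e to a point close to the part of al lying beyond p phi also follows
   the translate pX for long. *)
Lemma geodesic_to_later p phi al L i j k s t c z kap n : geodesic_seg S al L ->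
  i <= j -> j <= k -> k <= L -> X phi ->
  d (al i) p <= s -> d (al j) (p * phi) <= s -> d z (al k) <= c ->
  projects_near p e e t -> geod e z kap n -> 3 * s + c + t + 2 * D + 3 * E < d e phi ->
  exists i' j' v, [/\ i' <= n, j' <= n, X v, d (kap i') p <= E + t &
    d (kap j') (p * v) <= E /\ d e phi <= d e v + (3 * s + c + D + 3 * E)].
Proof.
move=> hal ij jk kL Xp hi hj hz ne gk big.
have [w pw] := proj_exists S (ginv p * al k) X1.
have [v pv] := proj_exists S (ginv p * z) X1.
have [w0 pw0] := proj_exists S (ginv p * e) X1.
have h1 := later_projection hal ij jk kL Xp hi hj pw.
have h2 := proj_lipschitz gen contrX pv pw; rewrite dist_mull // in h2.
have h3 := ne _ pw0.
have h4 : d e phi <= d e v + (3 * s + c + D + 3 * E).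
  have := tri e v w; lia.
have [|i' [j' [ij' jn hi' hj']]] := crossing gk pw0 pv.
  have := tri e w0 v; rewrite (dC e w0); lia.
exists i', j', v; split=> //; [lia|exact: pv.1|].
have := tri (kap i') (p * w0) (p * e); rewrite dist_mull // gmulr1; lia.
Qed.

Lemma position_or_crossing p phi g' t z a' kap n : X phi ->
  projects_near p e e t -> projects_near p g' phi t ->
  d e a' <= c0 -> projects_near (z * a') e e t0 -> projects_near (z * a') g' phi t0 ->
  geod e z kap n -> 4 * t + 2 * t0 + c0 + 2 * D + 7 * E < d e phi ->
  d e z <= d e p + d e phi + (t + t0 + c0 + 2 * E) \/
  exists i' j' v, [/\ i' <= n, j' <= n, X v, d (kap i') p <= E + t &
    d (kap j') (p * v) <= E /\ d e phi <= d e v + (3 * t + t0 + c0 + D + 7 * E)].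
Proof.
move=> Xp pe pg la' pe' pg' gk big.
have [al gal] := geodesic_exists gen e g'; case: (gal) => hal al0 _.
have [|i [j [ij jL hi hj]]] := crossing_near gal pe pg; first lia.
have [|i2 [j2 [ij2 jL2 hi2 _]]] := crossing_near gal pe' pg'; first lia.
rewrite gmulr1 in hi; rewrite gmulr1 in hi2.
have i2L := leq_trans ij2 jL2.
have hz : d z (al i2) <= c0 + E + t0.
  have := tri z (z * a') (al i2); rewrite dist_mulr // (dC (z * a') (al i2)); lia.
case: (leqP j i2) => ji2; [right|left].
  have [|i' [j' [v [? ? ? ? [? ?]]]]] :=
    geodesic_to_later hal ij ji2 i2L Xp (s := E + t) hi hj hz pe gk; first lia.
  by exists i', j', v; split=> //; split=> //; lia.
have h1 := geodesic_dist hal (leq0n i2) i2L; have h2 := geodesic_dist hal (leq0n j) jL.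
rewrite al0 in h1 h2.
have := tri e (al i2) z; have := lenM gen p phi; have := tri e (p * phi) (al j).
rewrite (dC (al i2) z) (dC (p * phi)); lia.
Qed.

Definition unobstructed c N k L := forall i j p v, i <= L -> j <= L -> X v ->
  d (k i) p <= c -> d (k j) (p * v) <= c -> d e v <= N.

Definition barrier_free c N g := exists k L, geod e g k L /\ unobstructed c N k L.

(* If g' = x u y = x2 u2 y2 and x y, x2 y2 are barrier-free, then both decompositions cut g'
   at nearly the same place. *)
Lemma barrier_free_position N phi g' x a x2 a2 k n : X phi ->
  d e a <= c0 -> projects_near (x * a) e e t0 -> projects_near (x * a) g' phi t0 ->
  d e a2 <= c0 -> projects_near (x2 * a2) e e t0 -> projects_near (x2 * a2) g' phi t0 ->
  geod e x2 k n -> unobstructed (E + t0) N k n ->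
  N + 6 * t0 + c0 + 2 * D + 7 * E < d e phi ->
  d e x2 <= d e x + (d e phi + 2 * t0 + 2 * c0 + 2 * E).
Proof.
move=> Xp la pe pg la2 pe2 pg2 gk free big.
have [|h|[i [j [v [iL jL Xv hi [hj hv]]]]]] :=
  position_or_crossing Xp pe pg la2 pe2 pg2 gk; first lia.
  have := lenM gen x a; lia.
have := free i j (x * a) v iL jL Xv hi (leq_trans hj (leq_addr t0 E)). lia.
Qed.

Local Notation t2 := (D + (2 * t0 + c0 + 3 * E))%N.

Lemma double_junction phi h x y : X phi ->
  D + 4 * E + c0 + 4 * t0 + D < d e phi -> 16 * E + 8 * t0 + 6 * c0 < d e h ->
  exists a1 b1 a2 b2, [/\ d e a1 <= c0, d e b1 <= c0, d e a2 <= c0 & d e b2 <= c0] /\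
  let u := connector a1 phi b1 in let v := connector a2 phi b2 in
  let g' := x * (u * (h * (v * y))) in
  [/\ projects_near (x * a1) e e t0, projects_near (x * a1) g' phi t0,
      projects_near (x * (u * (h * a2))) e e t2 &
      projects_near (x * (u * (h * a2))) g' phi t2].
Proof.
move=> Xp bigp bigh.
have [a2 [b2 [la2 lb2 pe2 pg2]]] := junction h y.
have [a1 [b1 [la1 lb1 pe1 pg1]]] := junction x (h * (connector a2 phi b2 * y)).
exists a1, b1, a2, b2; split=> // u v g'.
have {}pg1 : projects_near (x * a1) g' phi t0 by apply: pg1.
have {}pg2 : projects_near (x * (u * (h * a2))) g' phi t0.
  by move=> w; rewrite /g' !gE => pw; apply: (pg2 phi Xp); rewrite !gE.
have {}pe2 : projects_near (x * (u * (h * a2))) (x * u) e t0.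
  by move=> w; rewrite !gE => pw; apply: pe2; rewrite !gE.
split=> //; last by apply: projects_nearW pg2; lia.
have [al gal] := geodesic_exists gen e g'; case: (gal) => hal al0 alL.
have [|i [j [ij jL hi hj]]] := crossing_near gal pe1 pg1; first lia.
have hju : d (x * u) (al j) <= E + t0 + c0.
  have -> : x * u = x * a1 * phi * ginv b1 by rewrite /u /connector !gE.
  have := tri (x * a1 * phi * ginv b1) (x * a1 * phi) (al j).
  rewrite (dC _ (x * a1 * phi)) dist_mulr // len_inv // (dC (x * a1 * phi) (al j)); lia.
have pej := projects_near_close pe2 hju.
have galR := geodesic_sub hal jL (leqnn _); rewrite alL in galR.
have galL := geodesic_sub hal (leq0n j) jL; rewrite al0 in galL.
have [|i3 [j3 [ij3 jL3 hi3 _]]] := crossing_near galR pej pg2; first lia.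
rewrite gmulr1 in hi3.
move=> w pw; rewrite leqNgt; apply/negP => far.
have [w' pw'] := proj_exists S (ginv (x * (u * (h * a2))) * al j) X1.
have nw' := pej _ pw'.
have [|i4 [j4 [ij4 jL4 _ hj4]]] := crossing galL pw pw'.
  have := tri w w' e; lia.
have hj4' : d (al (0 + j4)) (x * (u * (h * a2))) <= E + (2 * t0 + c0 + 3 * E).
  have := tri (al (0 + j4)) (x * (u * (h * a2)) * w') (x * (u * (h * a2))).
  rewrite (dC (_ * w')) dist_mulr // (dC e w'); lia.
have iL3 : j + i3 <= d e g' by lia.
have j4j : 0 + j4 <= j by lia.
have h1 := geodesic_dist hal (leq_trans j4j (leq_addr i3 j)) iL3.
have h2 := geodesic_dist hal (leq_addr i3 j) iL3.
have h3 := tri (al (0 + j4)) (x * (u * (h * a2))) (al (j + i3)).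
have h4 := tri (al j) (al (j + i3)) (x * (u * (h * a2))).
have h5 := tri (x * u) (al j) (x * (u * (h * a2))).
have h6 : d (x * u) (x * (u * (h * a2))) = d e (h * a2) by rewrite gmulA dist_mulr.
have h7 := tri e (h * a2) h.
have h8 : d (h * a2) h <= c0 by rewrite dC dist_mulr.
rewrite (dC (x * (u * (h * a2))) (al (j + i3))) in h3; lia.
Qed.

End Junctions.

(** * Counting in balls and spheres *)

Lemma size_coding (T U : eqType) (A : seq T) (C : seq U) (Rel : T -> U -> Prop) : uniq A ->
  (forall t, t \in A -> exists2 c, c \in C & Rel t c) ->
  (forall t t' c, t \in A -> t' \in A -> Rel t c -> Rel t' c -> t = t') ->
  size A <= size C.
Proof.
move=> uA ex inj; case: A uA ex inj => // t0 A uA ex inj.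
have [c0 _ _] := ex t0 (mem_head _ _).
have [f hf] : {f : T -> U & forall t, t \in t0 :: A -> f t \in C /\ Rel t (f t)}.
  apply: (@choice T U (fun t c => t \in t0 :: A -> c \in C /\ Rel t c)) => t.
  by case: (boolP (t \in t0 :: A)) => [/ex [c cC rc]|_]; [exists c|exists c0].
rewrite -(size_map f); apply: uniq_leq_size => [|_ /mapP [t tA ->]]; last by have [] := hf t tA.
rewrite map_inj_in_uniq // => t t' tA tA' eq; apply: (inj t t' (f t)) => //.
  by have [] := hf t tA.
by rewrite eq; have [] := hf t' tA'.
Qed.

Lemma mem_pairs (T U : eqType) (A : seq T) (B : seq U) x y :
  x \in A -> y \in B -> (x, y) \in [seq (x, y) | x <- A, y <- B].
Proof. by move=> xA yB; apply/allpairsP; exists (x, y). Qed.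

Lemma count_union_le (T : eqType) (A : seq T) (P : pred T) (Q : nat -> pred T) n w B :
  (forall t, t \in A -> P t -> exists2 i, i < n & Q i t) ->
  (forall i, i < n -> w * count (Q i) A <= B) -> w * count P A <= n * B.
Proof.
elim: n P => [|n IH] P cov bd.
  rewrite mul0n leqn0 muln_eq0; apply/orP; right.
  rewrite -leqn0 leqNgt -has_count; apply/hasP => - [t tA Pt].
  by have [] := cov t tA Pt.
have h1 : w * count (fun t => P t && ~~ Q n t) A <= n * B.
  apply: IH => [t tA /andP [Pt nQ]|i ni]; last by apply: bd; apply: ltnW.
  have [i + Qi] := cov t tA Pt; rewrite ltnS leq_eqVlt => /orP [/eqP ein|]; last by exists i.
  by rewrite -ein Qi in nQ.
have h2 := bd n (ltnSn n).
have h3 : count P A <= count (fun t => P t && ~~ Q n t) A + count (Q n) A.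
  elim: A {cov bd h1 h2 IH} => //= t A IH.
  by case: (P t) (Q n t) => -[] /=; lia.
rewrite mulSn; have := leq_mul (leqnn w) h3; rewrite mulnDr; lia.
Qed.

Section Counting.
Variables (G : group) (S : seq G).
Hypothesis gen : generates S.
Local Notation "x * y" := (gmul x y).
Local Notation e := (gone G).
Local Notation d := (Defs.dist S).
Local Notation geod := (geodesic_between S).
Local Notation tri := (dist_triangle gen).
Local Notation dC := (distC gen).
Local Notation cG := {classic G}.
Local Notation b n := (size (ball S n)).
Implicit Types (x y z : G) (P : G -> Prop).

Definition sphere P n : seq cG := [seq g <- ball S n | (d e g == n) && `[< P g >]].

Lemma sphere_uniq P n : uniq (sphere P n).
Proof. exact: filter_uniq (ball_uniq S n). Qed.

Lemma mem_sphere P n (g : cG) : g \in sphere P n <-> d e g = n /\ P g.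
Proof.
rewrite mem_filter mem_ball //; split.
  by case/andP => /andP [/eqP -> /asboolP Pg].
by move=> [-> Pg]; rewrite eqxx leqnn !andbT; apply/asboolP.
Qed.

Local Notation s n := (size (sphere (fun _ => True) n)).

Lemma sphere_le P n : size (sphere P n) <= s n.
Proof.
apply: uniq_leq_size (sphere_uniq P n) _ => g /mem_sphere [h _].
by apply/mem_sphere.
Qed.

Lemma sphere_le_ball n : s n <= b n.
Proof. by rewrite size_filter count_size. Qed.

Definition hereditary P := forall m n g, P g -> d e g = m + n ->
  exists x y, [/\ P x, P y, d e x = m, d e y = n & g = x * y].

Lemma split_length m n g : d e g = m + n -> exists x y, [/\ d e x = m, d e y = n & g = x * y].
Proof.
move=> hg; have [k [hk k0 kL]] := geodesic_exists gen e g.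
have hm : m <= d e g by lia.
exists (k m), (ginv (k m) * g); split; last by rewrite gmulKV.
- by rewrite -{1}k0 (geodesic_dist hk (leq0n m) hm) subn0.
- by rewrite -dist_len // -{1}kL (geodesic_dist hk hm (leqnn _)); lia.
Qed.

Lemma sphere_submult P m n : hereditary P ->
  size (sphere P (m + n)) <= size (sphere P m) * size (sphere P n).
Proof.
move=> her; rewrite -(size_allpairs pair).
apply: (size_coding (Rel := fun (g : cG) (c : cG * cG) => g = (c.1 * c.2 : G))) (sphere_uniq _ _) _ _.
  move=> g /mem_sphere [hg /her /(_ hg) [x [y [Px Py hx hy ->]]]].
  by exists (x : cG, y : cG) => //; apply: mem_pairs; apply/mem_sphere.
by move=> g g' c _ _ -> ->.
Qed.

(* Truncate a geodesic to an element of length N. *)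
Lemma annulus_le N w : size [seq g <- ball S (N + w) | N <= d e (g : G)] <= s N * b w.
Proof.
rewrite -(size_allpairs pair).
apply: (size_coding (Rel := fun (g : cG) (c : cG * cG) => g = (c.1 * c.2 : G))).
- exact: filter_uniq (ball_uniq S _).
- move=> g; rewrite mem_filter mem_ball // => /andP [Ng gNw].
  have [|x [y [hx hy gxy]]] := @split_length N (d e g - N) g; first lia.
  exists (x : cG, y : cG) => //; apply: mem_pairs; first by apply/mem_sphere.
  by rewrite mem_ball // hy; lia.
- by move=> g g' c _ _ -> ->.
Qed.

Lemma sphere_shrink N w : s N <= s (N - w) * b w.
Proof.
apply: leq_trans (annulus_le _ _).
apply: uniq_leq_size (sphere_uniq _ _) _ => g /mem_sphere [h _].
by rewrite mem_filter mem_ball // h; lia.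
Qed.

Lemma ball_submult m n : b (m + n) <= b m * b n.
Proof.
rewrite -(size_allpairs pair).
apply: (size_coding (Rel := fun (g : cG) (c : cG * cG) => g = (c.1 * c.2 : G))).
- exact: ball_uniq.
- move=> g; rewrite mem_ball // => gmn.
  set i := minn m (d e g).
  have [|x [y [hx hy gxy]]] := @split_length i (d e g - i) g; first lia.
  by exists (x : cG, y : cG) => //; apply: mem_pairs; rewrite mem_ball //; lia.
- by move=> g g' c _ _ -> ->.
Qed.

Lemma ball_gt0 n : 0 < b n.
Proof. by rewrite -has_predT; apply/hasP; exists (e : cG); rewrite // mem_ball // dist0. Qed.

Lemma ball_exp n : b n <= b 1 ^ n.
Proof.
elim: n => [|n IH]; last first.
  by rewrite expnS -add1n; apply: leq_trans (ball_submult _ _) _; rewrite leq_mul2l IH orbT.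
rewrite expn0; apply: (@uniq_leq_size _ _ [:: (e : cG)]) (ball_uniq S 0) _ => g.
by rewrite mem_ball // leqn0 => /eqP /dist_eq0 -> //; rewrite mem_head.
Qed.

Lemma ball_mono m n : m <= n -> b m <= b n.
Proof.
move=> mn; apply: uniq_leq_size (ball_uniq S m) _ => g.
by rewrite !mem_ball //; lia.
Qed.

Section Supermultiplicative.
Hypothesis infinite : forall n, exists g, n <= d e g.

Lemma sphere_gt0 n : 0 < s n.
Proof.
have [g hg] := infinite n; have [|x [y [hx hy gxy]]] := @split_length n (d e g - n) g; first lia.
by rewrite -has_predT; apply/hasP; exists (x : cG) => //; apply/mem_sphere.
Qed.

Variable c : nat.
Hypothesis junctions : forall x y, exists u, d e u <= c /\
  forall al L, geod e (x * (u * y)) al L -> exists2 i, i <= L & d (al i) x <= c.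

Lemma geodesic_choice : exists al : G -> nat -> G, forall g, geod e g (al g) (d e g).
Proof. by have [al hal] := choice (geodesic_exists gen e); exists al. Qed.

Lemma near_geodesic al L g x i : geod e g al L -> i <= L -> d (al i) x <= c ->
  exists y, d e y <= 2 * c /\ x = al (minn (d e x) L) * y.
Proof.
move=> [hal al0 alL] iL hi; exists (ginv (al (minn (d e x) L)) * x); rewrite gmulKV -dist_len //; split=> //.
have h1 := geodesic_dist hal (leq0n i) iL; rewrite al0 in h1.
have h2 := hal (minn (d e x) L) i (geq_minr _ _) iL.
have := tri e (al i) x; have := tri e x (al i); have := tri (al (minn (d e x) L)) (al i) x.
rewrite (dC x); lia.
Qed.

Lemma sphere_supermult_shift m n :
  s m * s n <= s (m + n - 3 * c) * (b (4 * c) * (b (2 * c) * b c)).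
Proof.
have [al hal] := geodesic_choice.
rewrite mulnA; set A := [seq g <- ball S (m + n - 3 * c + 4 * c) | m + n - 3 * c <= d e (g : G)].
apply: (@leq_trans (size A * (b (2 * c) * b c))); last by rewrite leq_mul2r annulus_le orbT.
rewrite -!(size_allpairs pair).
apply: (size_coding (Rel := fun (p : cG * cG) (q : cG * (cG * cG)) =>
  q.1 = (p.1 * (q.2.2 * p.2) : G) /\ p.1 = (al q.1 (minn m (d e q.1)) * q.2.1 : G))).
- by apply: allpairs_uniq; rewrite ?sphere_uniq // => -[? ?] [? ?].
- move=> _ /allpairsP [[x y] /= [/mem_sphere [hx _] /mem_sphere [hy _] ->]].
  have [u [hu near]] := junctions x y.
  have gal := hal (x * (u * y)); have [i iL hi] := near _ _ gal.
  have [z [hz xz]] := near_geodesic gal iL hi; rewrite hx in xz.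
  exists (x * (u * y) : cG, (z : cG, u : cG)) => //.
  apply: mem_pairs; last by apply: mem_pairs; rewrite mem_ball.
  case: gal => hgal al0 alL.
  have h1 := geodesic_dist hgal (leq0n i) iL; rewrite al0 in h1.
  have h2 := geodesic_dist hgal iL (leqnn _); rewrite alL in h2.
  have h3 : d x (x * (u * y)) = d e (u * y) by rewrite dist_mulr.
  have h4 := tri x (al (x * (u * y)) i) (x * (u * y)).
  have h5 := lenM gen (ginv u) (u * y); rewrite gmulK len_inv // in h5.
  have h6 := tri e (al (x * (u * y)) i) x.
  have h7 := lenM gen x (u * y); have h8 := lenM gen u y.
  rewrite (dC x (al _ i)) in h4; rewrite mem_filter mem_ball //; lia.
- move=> [x y] [x' y'] [g [z u]] _ _ /= [hg hx] [hg' hx'].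
  have xx : x = x' by rewrite hx.
  by move: hg'; rewrite hg -xx => /gmulI/gmulI ->.
Qed.

Lemma sphere_supermult : exists2 C, 0 < C & forall m n, s m * s n <= C * s (m + n).
Proof.
set C := (b (4 * c) * (b (2 * c) * b c))%N.
have C0 : 0 < C by rewrite !muln_gt0 !ball_gt0.
have up N w : s N <= C * s (N + w).
  apply: leq_trans (leq_pmulr _ (sphere_gt0 (w + 3 * c))) _.
  have -> : N + w = N + (w + 3 * c) - 3 * c by lia.
  by rewrite [leqRHS]mulnC sphere_supermult_shift.
exists (C * C)%N => [|m n]; first by rewrite muln_gt0 C0.
apply: leq_trans (sphere_supermult_shift m n) _; rewrite -/C mulnC -mulnA leq_mul2l.
apply/orP; right; case: (leqP (3 * c) (m + n)) => h.
  by have := up (m + n - 3 * c)%N (3 * c)%N; rewrite subnK.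
have -> : m + n - 3 * c = 0 by lia.
by have := up 0 (m + n).
Qed.

End Supermultiplicative.

Section Growth.
Variable C : nat.
Hypothesis C_gt0 : 0 < C.
Hypothesis s_gt0 : forall n, 0 < s n.
Hypothesis supermult : forall m n, s m * s n <= C * s (m + n).

Lemma sphere_mono m n : m <= n -> s m <= C * s n.
Proof. by move=> /subnKC <-; have := supermult m (n - m); have := s_gt0 (n - m); nia. Qed.

Lemma sphere_pow m k : s m ^ k <= C ^ k * s (k * m)%N.
Proof.
elim: k => [|k IH]; first by rewrite !expn0 mul1n.
rewrite !expnS mulSn; have := supermult m (k * m)%N; nia.
Qed.

(* Elements of the family factor into elements of length m, so a proportion below 1/(2C)
   on one sphere becomes exponentially small. *)
Lemma hereditary_decay P m k : hereditary P -> (2 * C)%N * size (sphere P m) <= s m ->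
  2 ^ k * size (sphere P (k * m)%N) <= s (k * m)%N.
Proof.
move=> her small.
have h : (2 * C) ^ k * size (sphere P (k * m)%N) <= s m ^ k.
  elim: k => [|k IH].
    rewrite !expn0 mul1n mul0n; apply: leq_trans (sphere_le P 0) _.
    exact: leq_trans (sphere_le_ball 0) (ball_exp 0).
  rewrite !expnS mulSn.
  apply: leq_trans (leq_mul (leqnn _) (sphere_submult m (k * m)%N her)) _.
  by rewrite mulnACA leq_mul.
have := leq_trans h (sphere_pow m k); rewrite expnMn mulnAC mulnC leq_mul2l.
by rewrite -leqn0 leqNgt expn_gt0 C_gt0.
Qed.

End Growth.

End Counting.

(** * Inserting a word into a geodesic *)

Section Insertion.
Variables (G : group) (S : seq G).
Hypothesis gen : generates S.
Local Notation "x * y" := (gmul x y).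
Local Notation e := (gone G).
Local Notation d := (Defs.dist S).
Local Notation geod := (geodesic_between S).
Local Notation tri := (dist_triangle gen).
Local Notation dC := (distC gen).
Local Notation cG := {classic G}.
Local Notation b n := (size (ball S n)).
Local Notation s n := (size (sphere S (fun _ => True) n)).
Implicit Types (x y z g u : G).

Variables (A : seq cG) (m c cu W : nat) (kap : G -> nat -> G) (good : G -> nat -> G -> Prop).
Local Notation ins g i u := (kap g i * (u * (ginv (kap g i) * g))).
Hypothesis uniqA : uniq A.
Hypothesis kapA : forall g : cG, g \in A -> geod e g (kap g) m.
Hypothesis insertable : forall (g : cG) i, g \in A -> i <= m ->
  exists u, d e u <= cu /\ good g i u.
Hypothesis near : forall (g : cG) i u al L, g \in A -> i <= m -> good g i u ->
  geod e (ins g i u) al L -> exists2 j, j <= L & d (al j) (kap g i) <= c.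
Hypothesis position : forall (g g2 : cG) i i2 u u2, g \in A -> g2 \in A ->
  i <= m -> i2 <= m -> good g i u -> good g2 i2 u2 -> ins g i u = ins g2 i2 u2 -> i2 <= i + W.

Lemma insertion_count : size A * m.+1 <=
  s (m - (2 * c + cu)) * (b (2 * c + 2 * cu) * ((2 * W).+1 * (b (2 * c) * b cu))).
Proof.
have [al hal] := geodesic_choice gen.
have [r hr] : {r : G -> nat & forall g' (g : cG) i u, g \in A -> i <= m -> good g i u ->
    ins g i u = g' -> r g' <= i + W /\ i <= r g' + W}.
  apply: (@choice G nat (fun g' r => forall (g : cG) i u, g \in A -> i <= m -> good g i u ->
    ins g i u = g' -> r <= i + W /\ i <= r + W)) => g'.
  case: (pselect (exists (g : cG) i u, [/\ g \in A, i <= m, good g i u & ins g i u = g'])).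
    move=> [g [i [u [gA im gd h]]]]; exists i => g2 i2 u2 gA2 im2 gd2 h2; split.
      by apply: (position gA2 gA im2 im gd2 gd); rewrite h2.
    by apply: (position gA gA2 im im2 gd gd2); rewrite h2.
  by move=> no; exists 0 => g i u gA im gd h; case: no; exists g, i, u.
set N := m - (2 * c + cu); set w := (2 * c + 2 * cu)%N; rewrite mulnA.
set B := [seq g <- ball S (N + w) | N <= d e (g : G)].
apply: (@leq_trans (size B * ((2 * W).+1 * (b (2 * c) * b cu)))); last first.
  by rewrite leq_mul2r annulus_le ?orbT.
rewrite -(size_iota 0 m.+1) -[(2 * W).+1](size_iota 0) -!(size_allpairs pair).
apply: (size_coding (Rel := fun (p : cG * nat) (q : cG * (nat * (cG * cG))) =>
  [/\ good p.1 p.2 q.2.2.2, q.1 = ins p.1 p.2 q.2.2.2, p.2 + W = r q.1 + q.2.1 &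
      kap p.1 p.2 = (al q.1 (minn p.2 (d e q.1)) * q.2.2.1 : G)])).
- by apply: allpairs_uniq; rewrite ?iota_uniq // => -[? ?] [? ?].
- move=> _ /allpairsP [[g i] [gA im ->]]; change (is_true (g \in A)) in gA.
  have {}im : i <= m by move: im; rewrite mem_iota add0n ltnS.
  have [u [hu gd]] := insertable gA im.
  have [hk k0 kL] := kapA gA.
  have hx : d e (kap g i) = i by rewrite -{1}k0 (geodesic_dist hk (leq0n i) im) subn0.
  have hy : d (kap g i) g = m - i by rewrite -{2}kL (geodesic_dist hk im (leqnn _)).
  have gal := hal (ins g i u); have [j jL hj] := near gA im gd gal.
  have [z [hz xz]] := near_geodesic gen gal jL hj; rewrite hx in xz.
  have [h1 h2] := hr _ _ _ _ gA im gd erefl.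
  exists (ins g i u : cG, (i + W - r (ins g i u), (z : cG, u : cG))); last first.
    by split=> //; change (i + W = r (ins g i u) + (i + W - r (ins g i u))); lia.
  apply: mem_pairs; last first.
    apply: mem_pairs; first by rewrite mem_iota; lia.
    by apply: mem_pairs; rewrite mem_ball.
  case: gal => hgal al0 alL.
  have e1 := geodesic_dist hgal (leq0n j) jL; rewrite al0 in e1.
  have e2 := geodesic_dist hgal jL (leqnn _); rewrite alL in e2.
  have e3 : d (kap g i) (ins g i u) = d e (u * (ginv (kap g i) * g)) by rewrite dist_mulr.
  have e4 := tri (kap g i) (al (ins g i u) j) (ins g i u).
  have e5 := lenM gen (ginv u) (u * (ginv (kap g i) * g)); rewrite gmulK len_inv // in e5.
  have e6 := tri e (al (ins g i u) j) (kap g i).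
  have e7 := lenM gen (kap g i) (u * (ginv (kap g i) * g)).
  have e8 := lenM gen u (ginv (kap g i) * g).
  rewrite -dist_len // in e5 e8.
  rewrite (dC (kap g i) (al _ j)) in e4.
  by rewrite mem_filter mem_ball //; lia.
- move=> [g i] [g2 i2] [g' [k [z u]]] _ _ [_ hg hk hx] [_ hg2 hk2 hx2].
  rewrite /= in hg hk hx hg2 hk2 hx2.
  have ii : i = i2 by lia.
  subst i2; have xx : kap g i = kap g2 i by rewrite hx hx2.
  by move: hg2; rewrite hg -xx => /gmulI/gmulI/gmulI ->.
Qed.

End Insertion.

(** * Barrier-free elements and elements without long excursions *)

Section Families.
Variables (G : group) (S : seq G) (H : G -> Prop).
Hypothesis gen : generates S.
Local Notation "x * y" := (gmul x y).
Local Notation e := (gone G).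
Local Notation d := (Defs.dist S).
Local Notation geod := (geodesic_between S).
Local Notation tri := (dist_triangle gen).
Local Notation dC := (distC gen).
Local Notation cG := {classic G}.
Local Notation b n := (size (ball S n)).
Local Notation s n := (size (sphere S (fun _ => True) n)).
Implicit Types (x y z g u p h t : G).

Lemma hereditary_barrier_free X c N : hereditary S (barrier_free S X c N).
Proof.
move=> m n g [k [L [gk free]]] hg; have hL := geodesic_between_len gk; case: (gk) => hk k0 kL.
have mL : m <= L by lia.
have sub1 := geodesic_sub hk (leq0n m) mL; rewrite k0 in sub1.
have sub2 := geodesic_mull gen (ginv (k m)) (geodesic_sub hk mL (leqnn L)).
rewrite gmulV kL in sub2.
exists (k m), (ginv (k m) * g); split; last by rewrite gmulKV.
- by do 2 eexists; split; [exact: sub1|] => i j p v iL jL; apply: free; lia.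
- do 2 eexists; split; [exact: sub2|] => i j p v iL jL Xv; rewrite !(dist_mulVl gen) gmulA.
  by apply: free => //; lia.
- by rewrite -(geodesic_between_len sub1); lia.
- by rewrite -(geodesic_between_len sub2); lia.
Qed.

Definition near_coset K t x := exists2 h, H h & d x (t * h) <= K.

Definition avoids K T g := forall al L t i j, geod e g al L -> i <= L -> j <= L ->
  near_coset K t (al i) -> near_coset K t (al j) -> d (al i) (al j) < T.

Lemma hereditary_avoids K T : hereditary S (avoids K T).
Proof.
move=> m n g av hg; have [x [y [hx hy gxy]]] := split_length gen hg; exists x, y.
have hxg : d x g = n by rewrite gxy dist_mulr.
split=> // al L t i j gal iL jL; have hL := geodesic_between_len gal.
- have [k gk] := geodesic_exists gen x g.
  have gcat := geodesic_cat gen gal gk (_ : L + d x g = d e g).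
  have := av _ _ t i j (gcat _); rewrite iL jL; apply; lia.
- have [k gk] := geodesic_exists gen e x.
  have gal' := geodesic_mull gen x gal; rewrite gmulr1 -gxy in gal'.
  have gcat := geodesic_cat gen gk gal' (_ : d e x + L = d e g).
  have val l : (if d e x + l <= d e x then k (d e x + l) else x * al (d e x + l - d e x)) = x * al l.
    case: (posnP l) => [->|l0].
      by rewrite addn0 leqnn; case: gk => _ _ ->; case: gal => _ -> _; rewrite gmulr1.
    by rewrite leqNgt -addn1 leq_add2l l0 addKn.
  have := av _ _ (x * t) (d e x + i) (d e x + j) (gcat _).
  rewrite !val dist_mull // => h [h1 Hh1 n1] [h2 Hh2 n2]; apply: h; try lia.
  + by exists h1; rewrite // -gmulA dist_mull.
  + by exists h2; rewrite // -gmulA dist_mull.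
Qed.

Variables (X : G -> Prop) (D c0 t0 : nat).
Hypothesis X1 : X e.
Hypothesis XM : forall x y, X x -> X y -> X (x * y).
Hypothesis XV : forall x, X x -> X (ginv x).
Hypothesis contrX : contracting S X D.
Hypothesis choiceX : forall z, exists a, d e a <= c0 /\
  forall w, proj S X (ginv a * z) w -> d e w <= t0.
Hypothesis unboundedX : forall n, exists2 phi, X phi & n <= d e phi.
Local Notation E := (2 * D + 2)%N.

Lemma axis_junctions : exists c, forall x y, exists u, d e u <= c /\
  forall al L, geod e (x * (u * y)) al L -> exists2 i, i <= L & d (al i) x <= c.
Proof.
have [phi Xphi big] := unboundedX (D + t0 + t0).+1.
exists (2 * c0 + d e phi + (E + t0 + c0))%N => x y.
have [a [v [la lv pe pg]]] := junction gen XM XV choiceX x y.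
exists (connector a phi v); split; first by have := connector_len gen phi la lv; lia.
move=> al L gal.
have [|i [j [ij jL hi _]]] := crossing_near gen X1 contrX gal pe (pg _ Xphi); first lia.
exists i; first lia.
rewrite gmulr1 in hi; have := tri (al i) (x * a) x.
rewrite (dC (x * a)) dist_mulr //; lia.
Qed.

Lemma axis_supermult : exists C,
  [/\ 0 < C, forall n, 0 < s n & forall m n, s m * s n <= C * s (m + n)].
Proof.
have inf n : exists g, n <= d e g by have [phi _ h] := unboundedX n; exists phi.
have [c hc] := axis_junctions; have [C C0 hC] := sphere_supermult gen inf hc.
by exists C; split=> // n; apply: sphere_gt0.
Qed.

Variable C : nat.
Hypothesis C_gt0 : 0 < C.
Hypothesis s_gt0 : forall n, 0 < s n.
Hypothesis supermult : forall m n, s m * s n <= C * s (m + n).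

Lemma small_proportion P m w Q : size (sphere S P m) * m.+1 <= s (m - w) * Q ->
  2 * C * C * Q <= m.+1 -> (2 * C)%N * size (sphere S P m) <= s m.
Proof.
move=> h small.
have h1 : s (m - w) <= C * s m by apply: sphere_mono => //; exact: leq_subr.
rewrite -(@leq_pmul2r m.+1) //.
apply: (@leq_trans (2 * C * (C * s m * Q))); last first.
  rewrite (_ : _ * _ = s m * (2 * C * C * Q))%N; last by lia.
  by rewrite leq_mul2l small orbT.
by rewrite -mulnA leq_mul2l (leq_trans h) ?orbT // leq_mul2r h1 orbT.
Qed.

Lemma barrier_free_decay N : exists2 M, 0 < M &
  forall k, 2 ^ k * size (sphere S (barrier_free S X (E + t0) N) (k * M)%N) <= s (k * M)%N.
Proof.
have [phi Xphi big] := unboundedX (N + 6 * t0 + c0 + 2 * D + 7 * E).+1.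
set BF := barrier_free S X (E + t0) N.
set c := (E + t0 + c0)%N; set cu := (2 * c0 + d e phi)%N.
set W := (d e phi + 2 * t0 + 2 * c0 + 2 * E)%N.
set Q := (b (2 * c + 2 * cu) * ((2 * W).+1 * (b (2 * c) * b cu)))%N.
exists (2 * C * C * Q).+1 => // k; set m := (2 * C * C * Q).+1.
apply: (hereditary_decay gen C_gt0) => //; first exact: hereditary_barrier_free.
apply: (@small_proportion _ _ (2 * c + cu) Q); last by rewrite /m; lia.
have [kap hkap] : {kap : G -> nat -> G & forall g, g \in (sphere S BF m : seq cG) ->
    geod e g (kap g) m /\ unobstructed S X (E + t0) N (kap g) m}.
  apply: (@choice G (nat -> G) (fun g k => g \in (sphere S BF m : seq cG) ->
    geod e g k m /\ unobstructed S X (E + t0) N k m)) => g.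
  case: (boolP (g \in (sphere S BF m : seq cG))) => [|_]; last by exists (fun _ => e).
  move=> /(mem_sphere gen) [hg [l [L [gl free]]]]; exists l => _.
  by rewrite -hg -(geodesic_between_len gl).
pose good g i u := exists a v, [/\ u = connector a phi v, d e a <= c0, d e v <= c0,
  projects_near S X (kap g i * a) e e t0 &
  projects_near S X (kap g i * a) (kap g i * (u * (ginv (kap g i) * g))) phi t0].
apply: (insertion_count gen (kap := kap) (good := good) (W := W)).
- exact: sphere_uniq.
- by move=> g /hkap [].
- move=> g i gA im.
  have [a [v [la lv pe pg]]] := junction gen XM XV choiceX (kap g i) (ginv (kap g i) * g).
  exists (connector a phi v); split; first exact: connector_len.
  by exists a, v; split=> //; apply: pg.
- move=> g i u al L gA im [a [v [_ la lv pe pg]]] gal.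
  have [|j [j' [jj jL hj _]]] := crossing_near gen X1 contrX gal pe pg; first lia.
  exists j; first lia.
  rewrite gmulr1 in hj; have := tri (al j) (kap g i * a) (kap g i).
  rewrite (dC (kap g i * a)) dist_mulr //; lia.
- move=> g g2 i i2 u u2 gA gA2 im im2 [a [v [_ la _ pe pg]]] [a2 [v2 [_ la2 _ pe2 pg2]]] eqg.
  rewrite -eqg in pg2.
  have [[hk k0 kL] _] := hkap _ gA; have [[hk2 k02 kL2] free] := hkap _ gA2.
  have hx : d e (kap g i) = i by rewrite -{1}k0 (geodesic_dist hk (leq0n i) im) subn0.
  have hx2 : d e (kap g2 i2) = i2 by rewrite -{1}k02 (geodesic_dist hk2 (leq0n i2) im2) subn0.
  have gk2 := geodesic_sub hk2 (leq0n i2) im2; rewrite k02 in gk2.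
  have := barrier_free_position gen X1 contrX Xphi la pe pg la2 pe2 pg2 gk2 _ big.
  rewrite hx hx2; apply => j j' p v' jL jL'; apply: free; lia.
Qed.

Variable r : nat.
Hypothesis coarseH : forall x y, H x -> H y ->
  exists k L, geod x y k L /\ forall i, i <= L -> exists2 h, H h & d (k i) h <= r.
Hypothesis infiniteH : forall n, exists x y, [/\ H x, H y & n < d x y].

Lemma chord_length l : exists h1 h2, [/\ H h1, H h2, l <= d h1 h2 & d h1 h2 <= l + 2 * r].
Proof.
have [x [y [Hx Hy far]]] := infiniteH (l + r).
have [k [L [gk near]]] := coarseH Hx Hy; have hL := geodesic_between_len gk.
have lL : l + r <= L by lia.
have [h Hh dh] := near _ lL; exists x, h; case: gk => hk k0 _.
have := geodesic_dist hk (leq0n _) lL; rewrite k0 => h1.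
have := tri x h (k (l + r)); have := tri x (k (l + r)) h; rewrite (dC h).
by split=> //; lia.
Qed.

(* Inserting a chord of a coset of H between two long powers creates a long excursion, which
   locates the insertion up to the length of the chord. *)
Lemma avoids_proportion : exists K Q, forall T m, Q ^ T.+1 <= m.+1 ->
  (2 * C)%N * size (sphere S (avoids K T) m) <= s m.
Proof.
set t2 := (D + (2 * t0 + c0 + 3 * E))%N.
have [phi Xphi big] := unboundedX (4 * t2 + 6 * t0 + 2 * c0 + 4 * D + 11 * E).+1.
set F := d e phi in big.
set K := (E + t2 + c0 + F)%N.
set c := (E + t0 + c0)%N.
set l0 := (2 * K + (16 * E + 8 * t0 + 6 * c0) + 1)%N.
set cu0 := (2 * (2 * c0 + F) + l0 + 2 * r)%N.
set W0 := (4 * c0 + 2 * F + l0 + 2 * r + (t2 + t0 + 2 * E))%N.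
set beta := (b 1 + 2 + 2 * C * C)%N.
set A := (1 + (2 * c + 2 * cu0) + (2 * W0).+1 + 2 * c + cu0)%N.
exists K, (beta ^ (A + 5)) => T m large.
pose cu := (cu0 + T)%N; pose W := (W0 + T)%N.
set Q := (b (2 * c + 2 * cu) * ((2 * W).+1 * (b (2 * c) * b cu)))%N.
apply: (@small_proportion _ _ (2 * c + cu) Q); last first.
  apply: leq_trans large; rewrite -expnM.
  have ball_beta n : b n <= beta ^ n.
    apply: leq_trans (ball_exp gen n) _; case: n => // n.
    by rewrite leq_exp2r // /beta; lia.
  have C_beta : 2 * C * C <= beta ^ 1 by rewrite expn1 /beta; lia.
  have W_beta : (2 * W).+1 <= beta ^ (2 * W).+1.
    by apply: leq_trans (ltnW (ltn_expl _ (ltnSn 1))) _; rewrite leq_exp2r // /beta; lia.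
  apply: (@leq_trans (beta ^ (1 + ((2 * c + 2 * cu) + ((2 * W).+1 + (2 * c + cu)))))).
    have := leq_mul C_beta (leq_mul (ball_beta (2 * c + 2 * cu)%N) (leq_mul W_beta
      (leq_mul (ball_beta (2 * c)%N) (ball_beta cu)))).
    by rewrite -!expnD.
  rewrite leq_exp2l; last by rewrite /beta; lia.
  have hA : 1 + (2 * c + 2 * cu + ((2 * W).+1 + (2 * c + cu))) <= A + 5 * T.
    by rewrite /A /cu /W; lia.
  by apply: leq_trans hA _; rewrite mulnS mulnDl; lia.
have [h1 [h2 [Hh1 Hh2 hlo hhi]]] := chord_length (T + l0).
set h := ginv h1 * h2.
have lenh : d e h = d h1 h2 by rewrite (dist_len gen h1).
have [al hal] := geodesic_choice gen.
have kapA (g : cG) : g \in sphere S (avoids K T) m -> geod e g (al g) m.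
  by move=> /(mem_sphere gen) [hg _]; rewrite -[X in geod _ _ _ X]hg.
pose ins g i u := al g i * (u * (ginv (al g i) * g)).
pose good g i u := exists a1 b1 a2 b2,
  [/\ d e a1 <= c0, d e b1 <= c0, d e a2 <= c0, d e b2 <= c0 &
      u = connector a1 phi b1 * (h * connector a2 phi b2)] /\
  [/\ projects_near S X (al g i * a1) e e t0,
      projects_near S X (al g i * a1) (ins g i u) phi t0,
      projects_near S X (al g i * (connector a1 phi b1 * (h * a2))) e e t2 &
      projects_near S X (al g i * (connector a1 phi b1 * (h * a2))) (ins g i u) phi t2].
apply: (insertion_count gen (kap := al) (good := good) (W := W)) => //.
- exact: sphere_uniq.
- move=> g i gA im.
  have [||a1 [b1 [a2 [b2 [[la1 lb1 la2 lb2] /= [pe1 pg1 pe2 pg2]]]]]] :=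
    double_junction gen X1 XM XV contrX choiceX (h := h) (al g i) (ginv (al g i) * g) Xphi.
  + by rewrite -/F; lia.
  + by rewrite lenh; lia.
  exists (connector a1 phi b1 * (h * connector a2 phi b2)); split; last first.
    by exists a1, b1, a2, b2; rewrite /ins !gmulAr; rewrite !gmulAr in pg1 pg2 pe2.
  have := connector_len gen phi la1 lb1; have := connector_len gen phi la2 lb2.
  have := lenM gen (connector a1 phi b1) (h * connector a2 phi b2).
  by have := lenM gen h (connector a2 phi b2); rewrite -/F /cu; lia.
- move=> g i u k L gA im [a [v [a2 [v2 [[la lv _ _ _] [pe pg _ _]]]]]] gk.
  have [|j [j' [jj jL hj _]]] := crossing_near gen X1 contrX gk pe pg.
    by rewrite -/F; lia.
  exists j; first lia.
  rewrite gmulr1 in hj; have := tri (k j) (al g i * a) (al g i).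
  by rewrite (dC (al g i * a)) dist_mulr // /c; lia.
move=> g g2 i i2 u u2 gA gA2 im im2.
move=> [a1 [b1 [a2 [b2 [[la1 lb1 la2 lb2 hu] [pe1 pg1 pe2 pg2]]]]]].
move=> [a1' [b1' [a2' [b2' [[la1' _ _ _ _] [pe1' pg1' _ _]]]]]] eqg.
rewrite /ins -eqg -/(ins g i u) in pg1'.
have gk := kapA _ gA; have gk2 := kapA _ gA2.
case: (gk) (gk2) => hk k0 _ [hk2 k02 _].
have hx : d e (al g i) = i by rewrite -{1}k0 (geodesic_dist hk (leq0n i) im) subn0.
have hx2 : d e (al g2 i2) = i2 by rewrite -{1}k02 (geodesic_dist hk2 (leq0n i2) im2) subn0.
have sub2 := geodesic_sub hk2 (leq0n i2) im2; rewrite k02 in sub2.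
have len1 := connector_len gen phi la1 lb1.
have [||[k1 [_ [_ [k1i _ _ near1 _]]]]] :=
  position_or_crossing gen X1 contrX Xphi pe1 pg1 la1' pe1' pg1' sub2.
- by rewrite -/F; lia.
- have := lenM gen (al g i) a1; rewrite hx hx2 -/F /W; lia.
have [||[k2 [_ [_ [k2i _ _ near2 _]]]]] :=
  position_or_crossing gen X1 contrX Xphi pe2 pg2 la1' pe1' pg1' sub2.
- by rewrite -/F; lia.
- have := lenM gen (al g i) (connector a1 phi b1 * (h * a2)).
  have := lenM gen (connector a1 phi b1) (h * a2); have := lenM gen h a2.
  by rewrite hx hx2 -/F in len1 *; rewrite /W; lia.
exfalso; set u1 := connector a1 phi b1 in near2 len1.
have [_ av] := (mem_sphere gen _ _ _).1 gA2.
have := av _ _ (al g i * (u1 * ginv h1)) k1 k2 gk2.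
rewrite add0n in near1; rewrite add0n in near2.
have d1 : d (al g i * a1) (al g i * u1) <= F + c0.
  rewrite dist_mull // /u1 /connector dist_mulr //.
  by have := lenM gen phi (ginv b1); rewrite len_inv // -/F; lia.
clearbody u1.
have d2 : d (al g i * (u1 * (h * a2))) (al g i * (u1 * h)) <= c0.
  by rewrite !dist_mull // dC dist_mulr.
have d3 : d (al g i * u1) (al g i * (u1 * h)) = d h1 h2 by rewrite gmulA dist_mulr.
have e1 := tri (al g2 k1) (al g i * a1) (al g i * u1).
have e2 := tri (al g2 k2) (al g i * (u1 * (h * a2))) (al g i * (u1 * h)).
have e3 := tri (al g i * u1) (al g2 k1) (al g i * (u1 * h)).
have e4 := tri (al g2 k1) (al g2 k2) (al g i * (u1 * h)).
rewrite (dC (al g i * u1) (al g2 k1)) in e3.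
have n1 : near_coset K (al g i * (u1 * ginv h1)) (al g2 k1).
  by exists h1; rewrite // !gE /K; lia.
have n2 : near_coset K (al g i * (u1 * ginv h1)) (al g2 k2).
  by exists h2; rewrite // !gmulAr -/h /K; lia.
move=> /(_ _ _ n1 n2); rewrite /K in hlo *; lia.
Qed.

Lemma decay_all_lengths P M : hereditary S P -> 0 < M ->
  (forall k, 2 ^ k * size (sphere S P (k * M)%N) <= s (k * M)%N) ->
  forall m, 2 ^ (m %/ M) * size (sphere S P m) <= C * s m.
Proof.
move=> her M0 dec m; rewrite {2 3}(divn_eq m M).
apply: leq_trans (supermult _ _).
apply: leq_trans (leq_mul (leqnn _) (sphere_submult gen (m %/ M * M)%N (m %% M)%N her)) _.
by rewrite mulnA leq_mul // sphere_le.
Qed.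

Variable B : nat.
Hypothesis independentH : forall t h1 h2 w1 w2, H h1 -> H h2 ->
  proj S X (t * h1) w1 -> proj S X (t * h2) w2 -> d w1 w2 <= B.

Lemma chord_barrier_free h1 h2 : H h1 -> H h2 ->
  barrier_free S X (E + t0) (B + 4 * (r + (E + t0))) (ginv h1 * h2).
Proof.
move=> Hh1 Hh2; have [k [L [gk near]]] := coarseH Hh1 Hh2.
have := geodesic_mull gen (ginv h1) gk; rewrite gmulV => gk'.
do 2 eexists; split; first exact: gk'.
move=> i j p v iL jL Xv; rewrite !(dist_mulVl gen) => hi hj.
have [x Hx dx] := near i iL; have [y Hy dy] := near j jL.
have [w1 pw1] := proj_exists S (ginv (h1 * p) * x) X1.
have [w2 pw2] := proj_exists S (ginv (h1 * p) * y) X1.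
have dw := independentH Hx Hy pw1 pw2.
have e1 := pw1.2 e X1; have e2 := pw2.2 v Xv.
have n1 : d (ginv (h1 * p) * x) e <= r + (E + t0).
  rewrite dist_mulVl // gmulr1; have := tri x (k i) (h1 * p); rewrite (dC x (k i)); lia.
have n2 : d (ginv (h1 * p) * y) v <= r + (E + t0).
  rewrite dist_mulVl // gmulAr; have := tri y (k j) (h1 * (p * v)); rewrite (dC y (k j)); lia.
have := tri e (ginv (h1 * p) * x) w1; rewrite (dC e (ginv (h1 * p) * x)).
have := tri w2 (ginv (h1 * p) * y) v; rewrite (dC w2 (ginv (h1 * p) * y)).
have := tri e w1 v; have := tri w1 w2 v; lia.
Qed.

Definition coset_chord K q := exists t x y,
  [/\ near_coset K t x, near_coset K t y & q = ginv x * y].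

Lemma coset_chord_decay K : exists2 M, 0 < M & exists C', forall m,
  2 ^ (m %/ M) * size (sphere S (coset_chord K) m) <= C' * s m.
Proof.
set N := (B + 4 * (r + (E + t0)))%N; set BF := barrier_free S X (E + t0) N.
have [M M0 dec] := barrier_free_decay N.
have {}dec := decay_all_lengths (hereditary_barrier_free (N := N)) M0 dec.
exists M => //; exists ((4 * K).+1 * (2 ^ (2 * K) * (C * (C * b (4 * K)))) * (b K * b K))%N => m.
pose A : seq cG := [seq g <- ball S (m + 2 * K) | (m - 2 * K <= d e (g : G)) && `[< BF g >]].
have sizeA : 2 ^ (m %/ M) * size A <= (4 * K).+1 * (2 ^ (2 * K) * (C * (C * b (4 * K))) * s m).
  rewrite size_filter; apply: (@count_union_le cG _ _
    (fun i g => (d e (g : G) == m - 2 * K + i)%N && `[< BF g >])).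
    move=> g; rewrite mem_ball // => gle /andP [gge ->].
    by exists (d e g - (m - 2 * K)); [lia|rewrite andbT; apply/eqP; lia].
  move=> i ilt; set m' := (m - 2 * K + i)%N.
  have h1 : count (fun g : cG => (d e g == m') && `[< BF g >]) (ball S (m + 2 * K)) <=
      size (sphere S BF m').
    rewrite -size_filter; apply: uniq_leq_size; first exact: filter_uniq (ball_uniq S _).
    by move=> g; rewrite mem_filter => /andP [/andP [/eqP hg /asboolP Pg] _]; apply/mem_sphere.
  have h2 : 2 ^ (m %/ M) <= 2 ^ (2 * K) * 2 ^ (m' %/ M).
    rewrite -expnD leq_exp2l //.
    have h : m <= m' + 2 * K * M by rewrite /m'; nia.
    by apply: leq_trans (leq_div2r M h) _; rewrite addnC divnMDl.
  have h3 : s m' <= C * b (4 * K) * s m.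
    case: (leqP m' m) => mm.
      apply: leq_trans (sphere_mono C_gt0 s_gt0 supermult mm) _.
      by rewrite -mulnA leq_mul2l leq_pmull ?orbT // ball_gt0.
    have := sphere_shrink gen m' (m' - m).
    have -> : m' - (m' - m) = m by lia.
    have : b (m' - m) <= b (4 * K) by apply: ball_mono => //; lia.
    move=> b1 b2; apply: leq_trans b2 _; rewrite mulnC leq_mul2r; apply/orP; right.
    by apply: leq_trans b1 _; rewrite leq_pmull.
  apply: leq_trans (leq_mul h2 h1) _; rewrite -!mulnA leq_mul2l expn_eq0 /=.
  apply: leq_trans (dec m') _; rewrite leq_mul2l; apply/orP; right.
  by rewrite mulnA.
have code : size (sphere S (coset_chord K) m) <= size A * (b K * b K).
  rewrite -!(size_allpairs pair).
  apply: (size_coding (Rel := fun (q : cG) (c : cG * (cG * cG)) => q = (c.2.1 * (c.1 * c.2.2) : G))).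
  - exact: sphere_uniq.
  - move=> q /(mem_sphere gen) [hq [t [x [y [[h1 Hh1 n1] [h2 Hh2 n2] qxy]]]]].
    pose k1 := ginv x * (t * h1); pose k2 := ginv (t * h2) * y.
    have lk1 : d e k1 <= K by rewrite -dist_len.
    have lk2 : d e k2 <= K by rewrite -dist_len // dC.
    have qk : q = k1 * ((ginv h1 * h2) * k2) by rewrite qxy /k1 /k2 !gE.
    exists ((ginv h1 * h2 : cG), ((k1 : cG), (k2 : cG))) => //.
    apply: mem_pairs; last by apply: mem_pairs; rewrite mem_ball.
    rewrite mem_filter mem_ball //; apply/andP; split; last first.
      have -> : ginv h1 * h2 = ginv k1 * (q * ginv k2) by rewrite qk !gE.
      have := lenM gen (ginv k1) (q * ginv k2); have := lenM gen q (ginv k2).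
      rewrite !len_inv //; lia.
    apply/andP; split; last by apply/asboolP; apply: chord_barrier_free.
    have := lenM gen k1 ((ginv h1 * h2) * k2); have := lenM gen (ginv h1 * h2) k2.
    by rewrite -qk; lia.
  - by move=> q q' c _ _ -> ->.
apply: leq_trans (leq_mul (leqnn _) code) _.
rewrite mulnA; apply: leq_trans (leq_mul sizeA (leqnn _)) _.
by rewrite (mulnA (4 * K).+1) mulnAC.
Qed.

Lemma not_avoids_split K T g : ~ avoids K T g -> exists i m x q y,
  [/\ T <= m, d e x = i, d e q = m, coset_chord K q &
      [/\ i + m <= d e g, d e y = d e g - (i + m) & g = x * (q * y)]].
Proof.
move=> nav; apply: contrapT => no; apply: nav => al L t i j gal.
wlog ij : i j / i <= j => [hwlog|].
  move=> iL jL ni nj; case: (leqP i j) => ij; first exact: hwlog.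
  by rewrite dC; apply: hwlog => //; apply: ltnW.
move=> iL jL ni nj; rewrite ltnNge; apply/negP => Tm; apply: no.
have hL := geodesic_between_len gal; case: (gal) => hal al0 alL.
exists i, (d (al i) (al j)), (al i), (ginv (al i) * al j), (ginv (al j) * g).
have h1 := geodesic_dist hal (leq0n i) iL; have h2 := geodesic_dist hal ij jL.
have h3 := geodesic_dist hal jL (leqnn _).
rewrite al0 in h1; rewrite alL in h3.
split; rewrite -?dist_len //; first by rewrite h1 subn0.
  by exists t, (al i), (al j).
by split; [lia|lia|rewrite !gE].
Qed.

Lemma count_not_avoids K : exists2 M, 0 < M & exists C', forall n T,
  2 ^ (T %/ M) * count (fun g : cG => ~~ `[< avoids K T g >]) (ball S n) <= n.+1 ^ 3 * (C' * b n).
Proof.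
have [M M0 [C' dec]] := coset_chord_decay K.
exists M => //; exists (C' * C * C * C)%N => n T.
pose Q l i m (g : cG) := `[< exists x q y, [/\ T <= m, d e x = i, d e q = m, coset_chord K q &
      [/\ i + m <= l, d e y = l - (i + m) & g = x * (q * y) :> G]] >].
have -> : n.+1 ^ 3 = (n.+1 * (n.+1 * n.+1))%N by [].
rewrite -!mulnA.
apply: (@count_union_le cG _ _ (fun l g => (d e (g : G) == l) && ~~ `[< avoids K T g >])).
  by move=> g; rewrite mem_ball // => gn nav; exists (d e g); rewrite // eqxx.
move=> l ln.
apply: (@count_union_le cG _ _ (fun i g => `[< exists2 m, m < n.+1 & Q l i m g >])).
  move=> g _ /andP [/eqP hg /asboolP /not_avoids_split [i [m [x [q [y [h1 h2 h3 h4 [h5 h6 h7]]]]]]]].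
  rewrite hg in h5 h6; exists i; first lia.
  apply/asboolP; exists m; first lia.
  by apply/asboolP; exists x, q, y.
move=> i iln.
apply: (@count_union_le cG _ _ (fun m g => Q l i m g)).
  by move=> g _ /asboolP [m]; exists m.
move=> m mn; rewrite -size_filter.
case: (boolP ((T <= m) && (i + m <= l))) => [/andP [Tm iml]|no]; last first.
  rewrite (_ : size _ = 0) ?muln0 //; apply/eqP; rewrite size_eq0 -(negbK (_ == _)) -has_filter.
  by apply/hasP => -[g _ /asboolP [x [q [y [h1 _ _ _ [h5 _ _]]]]]]; rewrite h1 h5 in no.
have code : size [seq g <- ball S n | Q l i m g] <=
    s i * (size (sphere S (coset_chord K) m) * s (l - (i + m))).
  rewrite -!(size_allpairs pair).
  apply: (size_coding (Rel := fun (g : cG) (c : cG * (cG * cG)) => g = (c.1 * (c.2.1 * c.2.2) : G))).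
  - exact: filter_uniq (ball_uniq S n).
  - move=> g; rewrite mem_filter => /andP [/asboolP [x [q [y [_ h2 h3 h4 [_ h6 h7]]]]] _].
    exists ((x : cG), ((q : cG), (y : cG))) => //.
    by apply: mem_pairs; [|apply: mem_pairs]; apply/mem_sphere.
  - by move=> g g' c _ _ -> ->.
apply: leq_trans (leq_mul (leqnn _) code) _.
have h1 : 2 ^ (T %/ M) <= 2 ^ (m %/ M) by rewrite leq_exp2l // leq_div2r.
apply: leq_trans (leq_mul h1 (leqnn _)) _.
rewrite mulnCA (mulnA (2 ^ _)); apply: leq_trans (leq_mul (leqnn (s i)) (leq_mul (dec m) (leqnn _))) _.
have h2 := supermult m (l - (i + m)).
have h3 := supermult i (m + (l - (i + m))).
have il : i + (m + (l - (i + m))) = l by lia.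
rewrite il in h3; have h4 : s l <= C * b n.
  apply: leq_trans (sphere_mono C_gt0 s_gt0 supermult (_ : l <= n)) _; first lia.
  by rewrite leq_mul2l sphere_le_ball orbT.
apply: (@leq_trans (C' * (C * (C * s l)))); last by rewrite !leq_mul2l h4 !orbT.
apply: (@leq_trans (C' * (C * (s i * s (m + (l - (i + m)))))));
  last by rewrite !leq_mul2l h3 !orbT.
rewrite -(mulnA C') mulnCA leq_mul2l; apply/orP; right.
by rewrite [leqRHS]mulnCA leq_mul2l h2 orbT.
Qed.

Lemma sphere_exponential : exists2 M, 0 < M & forall k, 2 ^ k <= s (k * M)%N.
Proof.
set N := (B + 4 * (r + (E + t0)))%N.
have [M M0 dec] := barrier_free_decay N; exists M => // k.
apply: leq_trans (dec k); rewrite leq_pmulr //.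
have [h1 [h2 [Hh1 Hh2 far]]] := infiniteH (k * M).
have lh : d e (ginv h1 * h2) = k * M + (d h1 h2 - k * M).
  by rewrite -dist_len //; lia.
have [x [_ [Px _ hx _ _]]] := hereditary_barrier_free (chord_barrier_free Hh1 Hh2) lh.
by rewrite -has_predT; apply/hasP; exists (x : cG) => //; apply/mem_sphere.
Qed.

Lemma count_avoids : exists K Q M C', forall n T m, 0 < m -> Q ^ T.+1 <= m.+1 ->
  2 ^ (n %/ 2 %/ (m + M)) * count (fun g : cG => `[< avoids K T g >]) (ball S n) <= n.+1 * (C' * b n).
Proof.
have [K [Q small]] := avoids_proportion; have [M M0 expo] := sphere_exponential.
exists K, Q, M, (C * C)%N => n T m m0 large.
have {}small := small T m large.
have dec := decay_all_lengths (hereditary_avoids (K := K) (T := T)) m0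
  (fun k => hereditary_decay gen C_gt0 s_gt0 supermult k (hereditary_avoids (K := K) (T := T)) small).
apply: (@count_union_le cG _ _ (fun l g => (d e (g : G) == l) && `[< avoids K T g >])).
  by move=> g; rewrite mem_ball // => gn av; exists (d e g); rewrite // eqxx.
move=> l; rewrite ltnS => ln.
have h1 : count (fun g : cG => (d e g == l) && `[< avoids K T g >]) (ball S n) <=
    size (sphere S (avoids K T) l).
  rewrite -size_filter; apply: uniq_leq_size; first exact: filter_uniq (ball_uniq S _).
  by move=> g; rewrite mem_filter => /andP [/andP [/eqP hg /asboolP Pg] _]; apply/mem_sphere.
apply: leq_trans (leq_mul (leqnn _) h1) _.
apply: (@leq_trans (C * C * s n)); last by rewrite leq_mul2l sphere_le_ball orbT.
case: (leqP (n %/ 2) l) => hl.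
  have h2 : 2 ^ (n %/ 2 %/ (m + M)) <= 2 ^ (l %/ m).
    rewrite leq_exp2l //; apply: leq_trans (leq_div2r _ hl) _.
    by apply: leq_div2l => //; apply: leq_addr.
  apply: leq_trans (leq_mul h2 (leqnn _)) _; apply: leq_trans (dec l) _.
  by rewrite -mulnA leq_mul2l sphere_mono ?orbT.
set k := ((n - l) %/ M)%N.
have h2 : 2 ^ (n %/ 2 %/ (m + M)) <= 2 ^ k.
  rewrite leq_exp2l // /k; apply: (@leq_trans ((n - l) %/ (m + M))).
    by apply: leq_div2r; lia.
  by apply: leq_div2l => //; apply: leq_addl.
apply: leq_trans (leq_mul (leq_trans h2 (expo k)) (sphere_le gen _ l)) _.
apply: leq_trans (supermult _ _) _; rewrite -mulnA leq_mul2l; apply/orP; right.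
apply: sphere_mono => //; have := leq_divM (n - l) M; rewrite -/k; lia.
Qed.

End Families.

(** * Rates *)

Section Rates.
Variables (cnt : nat -> nat -> nat) (bd : nat -> nat).

Lemma poly_le_exp k x : x ^ k <= k ^ k * 2 ^ x.
Proof.
case: k => [|k]; first by rewrite !expn0 mul1n expn_gt0.
set q := (x %/ k.+1)%N.
have xq : x <= k.+1 * 2 ^ q.
  apply: (@leq_trans (k.+1 * q.+1)); last by rewrite leq_mul2l ltn_expl ?orbT.
  by rewrite mulnC ltnW // ltn_ceil.
apply: (@leq_trans ((k.+1 * 2 ^ q) ^ k.+1)); first by rewrite leq_exp2r.
by rewrite expnMn leq_mul2l -expnM leq_exp2l // leq_divM orbT.
Qed.

Lemma lower_rate Q M C : (forall n T m, 0 < m -> Q ^ T.+1 <= m.+1 ->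
    2 ^ (n %/ 2 %/ (m + M)) * cnt n T <= n.+1 * (C * bd n)) ->
  exists2 R, 1 < R & forall p, exists A, forall n, 0 < n ->
    n ^ p * cnt n (trunc_log R n) <= A * bd n.
Proof.
move=> h; set R := ((Q + 2) ^ 2)%N; have R1 : 1 < R by rewrite /R; nia.
exists R => // p; set a := (16 * R * M.+1 ^ 2)%N; set k := (2 * p.+1)%N.
exists (2 * a ^ p.+1 * (k ^ k * 4) * C)%N => n n0; set T := trunc_log R n.
set m := ((Q + 2) ^ T.+1)%N; set U := (n %/ 2 %/ (m + M))%N.
have m0 : 0 < m by rewrite expn_gt0; lia.
have hm : Q ^ T.+1 <= m.+1 by apply: leqW; rewrite leq_exp2r //; lia.
have mm : m ^ 2 <= R * n.
  by rewrite /m -expnM mulnC expnM -/R expnS leq_mul2l trunc_logP ?orbT.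
have nU : n <= 2 * (U + 2) * (m + M).
  have := ltn_ceil (n %/ 2) (_ : 0 < m + M); rewrite -/U => /(_ (leq_trans m0 (leq_addr _ _))).
  by have := ltn_ceil n (isT : 0 < 2); nia.
have nle : n <= a * (U + 2) ^ 2.
  rewrite -(leq_pmul2r n0).
  have mM : m + M <= 2 * M.+1 * m by nia.
  apply: (@leq_trans ((2 * (U + 2) * (2 * M.+1 * m)) ^ 2)).
    apply: (@leq_trans (n ^ 2)); first by rewrite expnS expn1.
    by rewrite leq_exp2r //; apply: leq_trans nU _; rewrite leq_mul2l mM orbT.
  rewrite (_ : (_ ^ 2 = 16 * (U + 2) ^ 2 * M.+1 ^ 2 * m ^ 2)%N); last by rewrite !expnMn; lia.
  rewrite (_ : (a * (U + 2) ^ 2 * n = 16 * (U + 2) ^ 2 * M.+1 ^ 2 * (R * n))%N); last by rewrite /a; lia.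
  by rewrite leq_mul2l mm orbT.
have npoly : n ^ p * n.+1 <= 2 * a ^ p.+1 * (k ^ k * 4) * 2 ^ U.
  apply: (@leq_trans (2 * n ^ p.+1)).
    by rewrite expnSr mulnCA leq_mul2l; apply/orP; right; lia.
  rewrite -!mulnA leq_mul2l /=; apply: (@leq_trans ((a * (U + 2) ^ 2) ^ p.+1)).
    by rewrite leq_exp2r.
  rewrite expnMn leq_mul2l -expnM; apply/orP; right.
  by apply: leq_trans (poly_le_exp k (U + 2)) _; rewrite expnD [(2 ^ U * _)%N]mulnC.
have := h n T m m0 hm; rewrite -/U => h'.
rewrite -(@leq_pmul2l (2 ^ U)) ?expn_gt0 // mulnCA.
apply: leq_trans (leq_mul (leqnn _) h') _.
rewrite mulnA; apply: leq_trans (leq_mul npoly (leqnn _)) _.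
by rewrite [leqRHS]mulnC -!mulnA [(C * _)%N]mulnC; apply: eq_leq; lia.
Qed.

Lemma upper_rate M C : 0 < M -> (forall n T,
    2 ^ (T %/ M) * cnt n T <= n.+1 ^ 3 * (C * bd n)) ->
  forall p, exists k A, forall n, 0 < n ->
    n ^ p * cnt n (k * trunc_log 2 n)%N <= A * bd n.
Proof.
move=> M0 h p; exists ((p + 3) * M)%N, (2 ^ (p + 3) * C)%N => n n0.
set l := trunc_log 2 n; have := h n ((p + 3) * M * l)%N.
have -> : ((p + 3) * M * l %/ M = (p + 3) * l)%N by rewrite mulnAC mulnK.
move=> h'; have n1 : n.+1 <= 2 * 2 ^ l by rewrite -expnS trunc_log_ltn.
have npoly : n ^ p * n.+1 ^ 3 <= 2 ^ (p + 3) * 2 ^ ((p + 3) * l).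
  apply: (@leq_trans (n.+1 ^ (p + 3))).
    by rewrite expnD leq_mul2r; apply/orP; right; case: (p) => // p'; rewrite leq_exp2r.
  by rewrite (mulnC _ l) expnM -expnMn; case: (p) => [|p']; rewrite leq_exp2r.
rewrite -(@leq_pmul2l (2 ^ ((p + 3) * l))) ?expn_gt0 // mulnCA.
apply: leq_trans (leq_mul (leqnn _) h') _.
rewrite mulnA; apply: leq_trans (leq_mul npoly (leqnn _)) _.
by apply: eq_leq; rewrite -!mulnA mulnCA.
Qed.

End Rates.

From Stdlib Require Import Reals Lra.

Lemma leq_INR m n : (INR m <= INR n)%R <-> (m <= n)%N.
Proof. by split=> [/INR_le /leP|/leP /le_INR]. Qed.

Lemma nat_above x : exists n, (x <= INR n)%R.
Proof. by have [n h] := INR_unbounded x; exists n; lra. Qed.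

Section Reduction.
Variables (G : group) (S : seq G) (H : G -> Prop).
Hypothesis gen : generates S.
Local Notation "x * y" := (gmul x y).
Local Notation e := (gone G).
Local Notation d := (Defs.dist S).
Local Notation tri := (dist_triangle gen).
Local Notation dC := (distC gen).
Local Notation cG := {classic G}.

Lemma contracting_line_nat D gam n : (D <= INR n)%R -> contracting_line S D gam ->
  contracting S (line_points gam) n.
Proof.
move=> Dn [_ con] k L hk far i j a c iL jL pa pc.
have h : (INR (d a c) < D)%R.
  apply: (con k L hk); last 2 first.
  - by exists (k i) => //; exists i.
  - by exists (k j) => //; exists j.
  by move=> x y Xx [m mL ->]; have := far m x mL Xx; rewrite (dC x) => /ltP /lt_INR; lra.
by apply/leq_INR; lra.
Qed.

Lemma near_cosetP K t x :
  nbhd S (INR K + /2) (translate t H) x <-> near_coset S H K t x.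
Proof.
split=> [[_ [h Hh ->] le]|[h Hh le]].
  exists h => //; rewrite -ltnS; apply/ltP/INR_lt; rewrite S_INR; lra.
exists (t * h); first by exists h.
by move/leq_INR: le; lra.
Qed.

Lemma excursion_lt_avoids K T g : excursion S H (INR K + /2) g < T -> avoids S H K T g.
Proof.
move=> small al L t i j gal iL jL ni nj; apply: leq_ltn_trans small.
have val : excursion_value S H (INR K + /2) g (d (al i) (al j)).
  by exists al, L, t, i, j; split=> //; apply/near_cosetP.
have le : d (al i) (al j) < (d e g).+1.
  rewrite ltnS -(geodesic_between_len gal); case: (gal) => hal _ _; rewrite hal; lia.
by apply: (@leq_bigmax_cond _ _ (fun m : 'I_(d e g).+1 => m : nat) (Ordinal le)); apply/asboolP.
Qed.

Lemma avoids_excursion_le K T g : 0 < T -> avoids S H K T g -> excursion S H (INR K + /2) g < T.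
Proof.
case: T => // T _ av; rewrite ltnS; apply/bigmax_leqP => m /asboolP.
move=> [al [L [t [i [j [gal [iL jL] ni nj <-]]]]]].
by rewrite -ltnS; apply: (av al L t i j) => //; apply/near_cosetP.
Qed.

Lemma coarse_nat : coarsely_geod_connected S H -> exists r, forall x y, H x -> H y ->
  exists k L, geodesic_between S x y k L /\
    forall i, i <= L -> exists2 h, H h & d (k i) h <= r.
Proof.
move=> [r [_ hr]]; have [n rn] := nat_above r; exists n => x y Hx Hy.
have [k [L [gk near]]] := hr x y Hx Hy; exists k, L; split=> // i iL.
have [h Hh le] := near i iL; exists h => //; apply/leq_INR; lra.
Qed.

Lemma infinite_nat : infinite_diam S H -> forall n, exists x y, [/\ H x, H y & n < d x y].
Proof.
move=> inf n; apply: contrapT => no; apply: (inf (INR n)) => x y Hx Hy.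
by apply/leq_INR; rewrite leqNgt; apply/negP => h; apply: no; exists x, y.
Qed.

Section Axis.
Variables (f : G) (D : R) (gam : int -> G).
Hypothesis axis : contracting_axis S D f gam.

Lemma line_close : exists M,
  (forall x, line_points gam x -> exists2 y, powers f y & d x y <= M) /\
  (forall y, powers f y -> exists2 x, line_points gam x & d y x <= M).
Proof.
have [_ [M [h1 h2]]] := axis; exists M; split.
  by move=> _ [j ->]; have [i hi] := h2 j; exists (gpow f i) => //; exists i.
by move=> _ [i ->]; have [j hj] := h1 i; exists (gam j) => //; exists j.
Qed.

Lemma powers_unbounded n : exists2 phi, powers f phi & n <= d e phi.
Proof.
have [M [h1 _]] := line_close; have [[line _] _] := axis.
have [x Xx hx] : exists2 y, powers f y & d (gam (Posz 0)) y <= M by apply: h1; exists (Posz 0).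
have [y Xy hy] : exists2 y, powers f y & d (gam (Posz (n + 2 * M))) y <= M.
  by apply: h1; eexists.
exists (ginv x * y); first by apply: powersM => //; apply: powersV.
rewrite -dist_len //; have := line (Posz 0) (Posz (n + 2 * M)).
have := tri (gam (Posz 0)) x (gam (Posz (n + 2 * M))).
have := tri x y (gam (Posz (n + 2 * M))); rewrite (dC y); lia.
Qed.

Lemma powers_contracting : exists D', contracting S (powers f) D'.
Proof.
have [M [h1 h2]] := line_close; have [n Dn] := nat_above D.
have con := contracting_line_nat Dn axis.1.
by eexists; apply: (contracting_hausdorff gen con h1 h2 (x := gam (Posz 0))); eexists.
Qed.

Lemma powers_independent : strongly_independent S gam H -> exists B, forall t h1 h2 w1 w2,
  H h1 -> H h2 -> proj S (powers f) (t * h1) w1 -> proj S (powers f) (t * h2) w2 ->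
  d w1 w2 <= B.
Proof.
move=> [B hB]; have [b Bb] := nat_above B.
have [M [hc1 hc2]] := line_close; have [n Dn] := nat_above D.
have con := contracting_line_nat Dn axis.1.
exists (b + 2 * (2 * (2 * n + 2) + M))%N => t h1 h2 w1 w2 Hh1 Hh2 p1 p2.
have X0 : line_points gam (gam (Posz 0)) by eexists.
have [a1 pa1] := proj_exists S (t * h1) X0; have [a2 pa2] := proj_exists S (t * h2) X0.
have e1 := proj_hausdorff gen con hc1 hc2 pa1 p1.
have e2 := proj_hausdorff gen con hc1 hc2 pa2 p2.
have : d a1 a2 <= b.
  apply/leq_INR; suff : (INR (d a1 a2) <= B)%R by lra.
  apply: (hB t).
  - by exists (t * h1) => //; exists h1.
  - by exists (t * h2) => //; exists h2.
have := tri w1 a1 w2; have := tri a1 a2 w2; rewrite (dC w1 a1); lia.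
Qed.

End Axis.

End Reduction.

(* [expn] is spelled out since [Reals] rebinds [^] on nat. *)
Lemma excursion_counts (G : group) (S : seq G) (H : G -> Prop) :
  generates S -> ~ virtually_cyclic G -> coarsely_geod_connected S H -> infinite_diam S H ->
  (exists (f : G) (D : R) (gam : int -> G),
      (0 < D)%R /\ contracting_axis S D f gam /\ strongly_independent S gam H) ->
  exists K,
    (exists2 Q, 1 < Q & forall p, exists A, forall n, 0 < n ->
      expn n p * count (fun g : {classic G} => `[< avoids S H K (trunc_log Q n) g >]) (ball S n)
        <= A * size (ball S n)) /\
    forall p, exists k A, forall n, 0 < n ->
      expn n p * count (fun g : {classic G} => ~~ `[< avoids S H K (k * trunc_log 2 n) g >]) (ball S n)
        <= A * size (ball S n).
Proof.
move=> gen nvc conn inf [f [D [gam [_ [axis indep]]]]].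
have [D' con] := powers_contracting gen axis.
have [c0 [t0 choiceX]] := axis_choice gen con nvc.
have [B indX] := powers_independent gen axis indep.
have [r coarse] := coarse_nat conn.
have infn := infinite_nat inf.
have unb := powers_unbounded gen axis.
have X1 := powers1 f; have XM := @powersM _ f; have XV := @powersV _ f.
have [C [C0 s0 super]] := axis_supermult gen X1 XM XV con choiceX unb.
have [K [Q [M [C1 low]]]] := count_avoids gen X1 XM XV con choiceX unb C0 s0 super coarse infn indX.
exists K; split; first exact: (lower_rate (cnt := fun n T =>
  count (fun g : {classic G} => `[< avoids S H K T g >]) (ball S n)) low).
have [M' M0 [C2 up]] := count_not_avoids gen X1 XM XV con choiceX unb C0 s0 super coarse indX K.
exact: (upper_rate (cnt := fun n T =>
  count (fun g : {classic G} => ~~ `[< avoids S H K T g >]) (ball S n)) M0 up).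
Qed.

Lemma INR_expn a k : INR (expn a k) = (INR a ^ k)%R.
Proof. by elim: k => //= k IH; rewrite expnS mult_INR IH. Qed.

Lemma trunc_log_le_ln q n : 1 < q -> 0 < n ->
  (INR (trunc_log q n) * ln (INR q) <= ln (INR n))%R.
Proof.
move=> q1 n0; have q0 : (0 < INR q)%R by apply: lt_0_INR; apply/ltP; lia.
rewrite -ln_pow // -INR_expn.
have le : (INR (expn q (trunc_log q n)) <= INR n)%R by apply/leq_INR; apply: trunc_logP.
case: (Rle_lt_or_eq_dec _ _ le) => [lt|->]; last by right.
by left; apply: ln_increasing => //; apply: lt_0_INR; apply/ltP; rewrite expn_gt0; lia.
Qed.

Lemma ln_lt_trunc_log q n : 1 < q -> 0 < n ->
  (ln (INR n) < (INR (trunc_log q n) + 1) * ln (INR q))%R.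
Proof.
move=> q1 n0; have q0 : (0 < INR q)%R by apply: lt_0_INR; apply/ltP; lia.
rewrite -S_INR -ln_pow // -INR_expn; apply: ln_increasing.
  by apply: lt_0_INR; apply/ltP.
by apply: lt_INR; apply/ltP; apply: trunc_log_ltn.
Qed.

Lemma ln_gt0 q : 1 < q -> (0 < ln (INR q))%R.
Proof. by move=> q1; rewrite -ln_1; apply: ln_increasing; [lra|apply: (lt_INR 1); apply/ltP]. Qed.

Lemma Rpower_opp_ge n p k : 0 < n -> (p <= INR k)%R ->
  (/ INR (expn n k) <= Rpower (INR n) (- p))%R.
Proof.
move=> n0 pk; have n1 : (1 <= INR n)%R by apply: (le_INR 1); apply/leP.
rewrite Rpower_Ropp; apply: Rinv_le_contravar; first exact: exp_pos.
rewrite INR_expn -Rpower_pow; last lra.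
exact: Rle_Rpower.
Qed.

Theorem theorem4p1 (G : group) (S : seq G) (H : G -> Prop) :
  generates S ->
  ~ virtually_cyclic G ->
  coarsely_geod_connected S H ->
  infinite_diam S H ->
  (exists (f : G) (D : R) (gam : int -> G),
      (0 < D)%R /\ contracting_axis S D f gam /\ strongly_independent S gam H) ->
  exists K : R, (0 < K)%R /\
    forall p : R, (0 < p)%R ->
      exists C1 C2 : R, (0 < C1)%R /\ (0 < C2)%R /\
        exists (c : R) (N : nat),
          forall n : nat, (N <= n)%N ->
            (1 - c * Rpower (INR n) (- p) <=
             Pn S n (fun g => C1 <= INR (excursion S H K g) / ln (INR n) <= C2))%R.
Proof.
move=> gen nvc conn inf ax.
have [K [[Q Q1 low] up]] := excursion_counts gen nvc conn inf ax.
exists (INR K + /2)%R; split; first by have := pos_INR K; lra.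
move=> p p0; have [P pP] := nat_above p.
have [A1 {}low] := low P; have [k [A2 {}up]] := up P.
have lnQ := ln_gt0 Q1; have ln2 := ln_gt0 (isT : 1 < 2).
have k0 := pos_INR k.
exists (/ (2 * ln (INR Q)))%R, ((INR k + 1) / ln (INR 2))%R.
split; first by apply: Rinv_0_lt_compat; lra.
split; first by apply: Rdiv_lt_0_compat; lra.
exists (INR A1 + INR A2)%R, Q => n Qn.
have n0 : 0 < n by lia.
have {}low := low n n0; have {}up := up n n0.
set T := trunc_log Q n in low; set l := trunc_log 2 n in up.
have T1 : 0 < T by rewrite /T -(trunc_lognn Q1) leq_trunc_log.
set good := (fun g => _).
have lnn : (0 < ln (INR n))%R by apply: ln_gt0; lia.
have bad (g : {classic G}) : ~~ `[< good g >] ->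
    `[< avoids S H K T g >] || ~~ `[< avoids S H K (k * l) g >].
  apply: contraNT; rewrite negb_or negbK => /andP [/asboolPn nav /asboolP av].
  have TE : T <= excursion S H (INR K + /2) g.
    by rewrite leqNgt; apply/negP => /excursion_lt_avoids /nav.
  have Ekl : excursion S H (INR K + /2) g <= k * l.
    rewrite -ltnS; apply: avoids_excursion_le => // al L t i j gal iL jL ni nj.
    by apply: leq_trans (av al L t i j gal iL jL ni nj) _.
  move/leq_INR: TE; move/leq_INR: Ekl; rewrite mult_INR.
  set x := INR (excursion _ _ _ _) => Ekl TE.
  have t1 := ln_lt_trunc_log Q1 n0; have t2 := trunc_log_le_ln (isT : 1 < 2) n0.
  rewrite -/T in t1; rewrite -/l in t2.
  have T1R : (1 <= INR T)%R by apply: (le_INR 1); apply/leP.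
  apply/asboolP; rewrite /good -/x; split.
    apply: (Rmult_le_reg_r (ln (INR n) * (2 * ln (INR Q)))); first by apply: Rmult_lt_0_compat; lra.
    rewrite (_ : (/ _ * _ = ln (INR n))%R); last by field; lra.
    rewrite (_ : (_ / _ * _ = x * (2 * ln (INR Q)))%R); last by field; lra.
    nra.
  apply: (Rmult_le_reg_r (ln (INR n) * ln (INR 2))); first by apply: Rmult_lt_0_compat; lra.
  rewrite (_ : (x / _ * _ = x * ln (INR 2))%R); last by field; lra.
  rewrite (_ : (_ / _ * _ = (INR k + 1) * ln (INR n))%R); last by field; lra.
  nra.
rewrite /Pn -/good; set b := ball S n in low up *.
have size_le : size b <= count (fun g : {classic G} => `[< good g >]) b +
   (count (fun g : {classic G} => `[< avoids S H K T g >]) b +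
    count (fun g : {classic G} => ~~ `[< avoids S H K (k * l) g >]) b).
  rewrite -(count_predC (fun g : {classic G} => `[< good g >])) leq_add2l -count_predUI.
  by apply: leq_trans (leq_addr _ _); apply: sub_count => g /bad.
have b0 : (0 < INR (size b))%R by apply: lt_0_INR; apply/ltP; apply: ball_gt0.
move: size_le low up.
set x := count _ b; set y := count _ b; set z := count _ b.
move=> /leq_INR; rewrite !plus_INR => hs /leq_INR; rewrite !mult_INR => hy /leq_INR.
rewrite !mult_INR => hz.
have np : (0 < INR (expn n P))%R by apply: lt_0_INR; apply/ltP; rewrite expn_gt0 n0.
have hp := Rpower_opp_ge n0 pP.
apply: (Rmult_le_reg_r (INR (size b))) => //.
rewrite (_ : (INR x / _ * _ = INR x)%R); last by field; lra.
have yz : (INR y + INR z <= (INR A1 + INR A2) * INR (size b) * / INR (expn n P))%R.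
  apply: (Rmult_le_reg_r (INR (expn n P))) => //.
  rewrite (_ : (_ * / _ * _ = (INR A1 + INR A2) * INR (size b))%R); last by field; lra.
  lra.
have a1 := pos_INR A1; have a2 := pos_INR A2.
have : ((INR A1 + INR A2) * INR (size b) * / INR (expn n P) <=
  (INR A1 + INR A2) * INR (size b) * Rpower (INR n) (- p))%R.
  by apply: Rmult_le_compat_l => //; apply: Rmult_le_pos; lra.
lra.
Qed.
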